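(* Let $X$ and $Y$ be Banach spaces with $\dim X=\infty$ and $\dim Y\ge 1$, and let $\xi=(\xi_j)_{j\ge 1}$ be a sequence of i.i.d. symmetric random variables with $\mathbb{E}|\xi_j|^2=1$. The following assertions are equivalent: \begin{enumerate} \item[(i)] There is a constant $K$, depending on $X$ and $Y$ only, such that for all $f_1,\dots,f_n\in {\rm Lip}_0(X,Y)$, all finite sequences $x_1,\ldots,x_n\in X$, and all scalars $a_1,\dots,a_n>0$ we have $$\Bigl(\mathbb{E}\Big\|\sum_{j=1}^n \xi_j a_j^{-1} f_j(a_j x_j)\Big\|^2\Bigr)^{\frac12}\leq K\big(\max_{1\le j\le n}\|f_j\|_{\rm Lip}\big)\Bigl(\mathbb{E}\Big\|\sum_{j=1}^n \xi_j x_j\Big\|^2\Bigr)^{\frac12}.$$ \item[(ii)] There is a constant $K$, depending on $X$ and $Y$ only, such that for all $f\in {\rm Lip}_0(X,Y)$ and all finite sequences $x_1,\ldots,x_n\in X$ there exist scalars $a_1,\dots,a_n>0$ such that $$\Bigl(\mathbb{E}\Big\|\sum_{j=1}^n \xi_j a_j^{-1} f(a_j x_j)\Big\|^2\Bigr)^{\frac12}\leq K\|f\|_{\rm Lip}\Bigl(\mathbb{E}\Big\|\sum_{j=1}^n \xi_j x_j\Big\|^2\Bigr)^{\frac12}.$$ \item[(iii)] $X$ has $\xi$-cotype $2$ and $Y$ has $\xi$-type $2$. \end{enumerate} If (ii) holds with constant $K$, then $C_2^{\xi}(X)\le K$ and $T_2^{\xi}(Y)\le (1+2\sqrt{2})K$.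 If the $\xi_j$ have finite moments of all orders, then (iii) is equivalent to \begin{enumerate} \item[(iv)] $X$ has cotype $2$ and $Y$ has type $2$. \end{enumerate}
   Context: ${\rm Lip}_0(X,Y)$ denotes the Banach space of all Lipschitz continuous functions $f:X\to Y$ with $f(0)=0$, with norm $\|f\|_{\rm Lip}$ equal to the (best) Lipschitz constant of $f$. A random variable is symmetric if it has the same distribution as its negative. The $\xi$-type $2$ constant $T_2^\xi(Y)$ is the least $T\in[0,\infty]$ such that $(\mathbb{E}\|\sum_{j=1}^n\xi_j y_j\|^2)^{1/2}\le T(\sum_{j=1}^n\|y_j\|^2)^{1/2}$ for all finite sequences $y_1,\dots,y_n\in Y$; $Y$ has $\xi$-type $2$ if $T_2^\xi(Y)<\infty$. The $\xi$-cotype $2$ constant $C_2^\xi(X)$ is the least $C\in[0,\infty]$ such that $(\sum_{j=1}^n\|x_j\|^2)^{1/2}\le C(\mathbb{E}\|\sum_{j=1}^n\xi_j x_j\|^2)^{1/2}$ for all finite sequences $x_1,\dots,x_n\in X$; $X$ has $\xi$-cotype $2$ if $C_2^\xi(X)<\infty$. (Ordinary) type $2$ and cotype $2$ are the same notions with $\xi$ replaced by a Rademacher sequence $(r_j)_{j\ge1}$, i.e. an i.i.d. sequence with $\mathbb{P}(r_j=1)=\mathbb{P}(r_j=-1)=\tfrac12$. *)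

(* Defs.v *)
From HB Require Import structures.
From mathcomp Require Export all_boot all_order all_algebra finmap.
From mathcomp Require Export all_classical all_reals all_analysis.
Export numFieldNormedType.Exports.
Export Order.TTheory GRing.Theory Num.Theory.

Set Implicit Arguments.
Unset Strict Implicit.
Unset Printing Implicit Defensive.

Local Open Scope classical_set_scope.
Local Open Scope ring_scope.

(* Banach spaces are taken over the reals.  Random sequences are indexed from 0
   and finite sequences by 'I_n, so that xi_1, ..., xi_n is xi 0, ..., xi n.-1. *)

Definition finite_dimensional (R : realType) (V : lmodType R) : Prop :=
  exists (n : nat) (v : 'I_n -> V),
    forall x : V, exists c : 'I_n -> R, x = \sum_(i < n) c i *: v i.

Definition independent_rvs d (T : measurableType d) (R : realType)
    (P : probability T R) (X : nat -> {RV P >-> R}) : Prop :=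
  forall (J : {fset nat}) (B : nat -> set R), (forall i, measurable (B i)) ->
    P (\bigcap_(i in [set` J]) (X i @^-1` B i)) =
    (\prod_(i <- J) P (X i @^-1` B i))%E.

Definition identically_distributed d (T : measurableType d) (R : realType)
    (P : probability T R) (X : nat -> {RV P >-> R}) : Prop :=
  forall (i j : nat) (B : set R), measurable B ->
    distribution P (X i) B = distribution P (X j) B.

Definition iid d (T : measurableType d) (R : realType)
    (P : probability T R) (X : nat -> {RV P >-> R}) : Prop :=
  independent_rvs X /\ identically_distributed X.

Definition symmetric_rv d (T : measurableType d) (R : realType)
    (P : probability T R) (X : {RV P >-> R}) : Prop :=
  forall B : set R, measurable B ->
    P (X @^-1` B) = P ((fun w => - X w) @^-1` B).

Definition rademacher d (T : measurableType d) (R : realType)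
    (P : probability T R) (r : nat -> {RV P >-> R}) : Prop :=
  iid r /\ forall j : nat, P (r j @^-1` [set 1]) = (2^-1)%:E /\
                           P (r j @^-1` [set -1]) = (2^-1)%:E.

Definition finite_moments d (T : measurableType d) (R : realType)
    (P : probability T R) (X : {RV P >-> R}) : Prop :=
  forall p : nat, ('E_P[fun w => (`|X w| ^+ p)%R] < +oo)%E.

Section RandomSums.
Context d (T : measurableType d) (R : realType) (P : probability T R).
Variable xi : nat -> {RV P >-> R}.

Definition random_sum_L2 (V : normedModType R) (n : nat) (x : 'I_n -> V) :
    \bar R :=
  sqrte 'E_P[fun w => (`|\sum_(j < n) xi j w *: x j| ^+ 2)%R]%E.

(* For square integrable xi the infimum is attained, hence is the least admissible
   constant; it is +oo exactly when there is no finite admissible constant. *)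
Definition type2_const (V : normedModType R) : \bar R :=
  ereal_inf [set C : \bar R | (0 <= C)%E /\
    forall (n : nat) (y : 'I_n -> V),
      (random_sum_L2 y <= C * (Num.sqrt (\sum_(j < n) `|y j| ^+ 2)%R)%:E)%E].

Definition cotype2_const (V : normedModType R) : \bar R :=
  ereal_inf [set C : \bar R | (0 <= C)%E /\
    forall (n : nat) (x : 'I_n -> V),
      ((Num.sqrt (\sum_(j < n) `|x j| ^+ 2)%R)%:E <= C * random_sum_L2 x)%E].

Definition has_type2 (V : normedModType R) : Prop :=
  (type2_const V < +oo)%E.

Definition has_cotype2 (V : normedModType R) : Prop :=
  (cotype2_const V < +oo)%E.

End RandomSums.

Definition Lip0 (R : realType) (X Y : normedModType R) : set (X -> Y) :=
  [set f | f 0 = 0 /\ lipschitz f].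

(* The constraint 0 <= k only matters when X is the zero space. *)
Definition Lip_norm (R : realType) (X Y : normedModType R) (f : X -> Y) : R :=
  inf [set k : R | 0 <= k /\ k.-lipschitz f].

Section RandomizedLipschitz.
Context d (T : measurableType d) (R : realType) (P : probability T R).
Variables (xi : nat -> {RV P >-> R}) (X Y : normedModType R).

Definition families_Lip_bounded (K : R) : Prop :=
  forall (n : nat) (f : 'I_n -> X -> Y) (x : 'I_n -> X) (a : 'I_n -> R),
    (forall j, Lip0 (f j)) -> (forall j, 0 < a j) ->
    (random_sum_L2 xi (fun j => (a j)^-1 *: f j (a j *: x j))%R <=
     K%:E * (\big[Num.max/0]_(j < n) Lip_norm (f j))%R%:E *
     random_sum_L2 xi x)%E.

Definition single_Lip_bounded (K : R) : Prop :=
  forall (f : X -> Y) (n : nat) (x : 'I_n -> X), Lip0 f ->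
    exists2 a : 'I_n -> R, (forall j, 0 < a j) &
    (random_sum_L2 xi (fun j => (a j)^-1 *: f (a j *: x j))%R <=
     K%:E * (Lip_norm f)%:E * random_sum_L2 xi x)%E.

End RandomizedLipschitz.

(* Main.v *)
Require Import Defs.
From mathcomp Require Import perm measurable_realfun lra ring.

(* (iii) => (i) is immediate from the definitions. For (ii) => (iii), testing
   with f = |.| y, |y| = 1, turns the inequality into cotype 2 of X, since the
   xi_j are orthonormal. For type 2 of Y, Dvoretzky's theorem is not needed: the
   Dvoretzky-Rogers lemma gives unit-like vectors e_j in X with
   |sum_j c_j e_j| <= |c|_2, and these are automatically so well separated that
   a positively homogeneous 2-Lipschitz map can send each ray through e_j onto
   any prescribed ray of Y.

   For (iv), |sum_j xi_j x_j|^2 has the same mean as its average over all sign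
   changes of the coefficients, which is monotone in each |xi_j|; so the averages
   with xi dominate those with Rademacher signs. Conversely, if X has xi-cotype 2,
   let C_n be its (finite) Rademacher cotype 2 constant for n nonzero vectors.
   Splitting the indices at random into about 1/p colour classes shows that a
   random selection of terms with density p reduces the mean square norm by a
   factor of order p C_n^2. Summing over the level sets of |xi| above M bounds the
   contribution of large values by C_n^2 / M^2, and for large M this gives an
   inequality C_n^2 <= D + C_n^2 / 2 with D independent of n. *)

Set Implicit Arguments.
Unset Strict Implicit.
Unset Printing Implicit Defensive.

Local Open Scope classical_set_scope.
Local Open Scope ring_scope.

(** * The Dvoretzky-Rogers lemma *)

(** In (ii) the scalars a_j are chosen after f and the x_j, so a test map has to be positively
    homogeneous: then a^-1 f(a x) = f(x) and the choice has no effect. This is why the map used for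
    type 2 prescribes whole rays and not points. The e_j serve twice: the bound |sum_j c_j e_j| <=
    |c|_2 controls the random sum in X on the right of (ii), and the same bound for two indices,
    with norms close to 1, keeps the rays apart.

    Cutting |xi_j| at the levels 2^k M costs a factor of order 2^k, from repeated use of |a + b|^2
    <= 2 |a|^2 + 2 |b|^2, and a factor of order 4^k M^2, from the size of the coefficients. The
    fourth moment bounds the probability of a level by a multiple of (2^k M)^-4, so the
    contributions decay like 2^-k.

    The Banach spaces carry no sigma-algebra: measurability and laws of |sum_j xi_j x_j|^2 are
    obtained from the real coefficients, approximated by functions with finitely many values. *)

Section SqNorm.
Context (R : realType).

(** The squared Euclidean norm, as opposed to the norm of row vectors, which is the sup norm. *)
Definition sqn n (c : 'rV[R]_n) : R := \sum_i c 0 i ^+ 2.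

Lemma sqnE n (c : 'rV[R]_n) : c *m c^T = (sqn c)%:M.
Proof.
apply/matrixP => i j; rewrite !ord1 !mxE eqxx mulr1n.
by apply: eq_bigr => k _; rewrite mxE expr2.
Qed.

(** [U *m U^T = 1%:M] says that the rows of U are orthonormal. Subspaces of l_2^k are represented by
    such matrices throughout, as the isometric images of [c |-> c *m U]. *)
Lemma sqn_mulmx n k (U : 'M[R]_(n, k)) (c : 'rV[R]_n) :
  U *m U^T = 1%:M -> sqn (c *m U) = sqn c.
Proof.
move=> UU; have := sqnE (c *m U).
rewrite trmx_mul mulmxA -(mulmxA c) UU mulmx1 sqnE.
by move=> /matrixP /(_ 0 0); rewrite !mxE eqxx !mulr1n => <-.
Qed.

Lemma sqn_ge0 n (c : 'rV[R]_n) : 0 <= sqn c.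
Proof. by apply: sumr_ge0 => i _; exact: sqr_ge0. Qed.

Lemma sqnZ n a (c : 'rV[R]_n) : sqn (a *: c) = a ^+ 2 * sqn c.
Proof. by rewrite /sqn mulr_sumr; apply: eq_bigr => i _; rewrite mxE exprMn. Qed.

Lemma sqn_eq0 n (c : 'rV[R]_n) : (sqn c == 0) = (c == 0).
Proof.
apply/eqP/eqP => [/eqP|->]; last first.
  by apply: big1 => i _; rewrite mxE expr0n.
rewrite psumr_eq0; last by move=> i _; exact: sqr_ge0.
by move=> /allP c0; apply/rowP => i; rewrite mxE; apply/eqP;
  rewrite -sqrf_eq0; exact: c0 (mem_index_enum i).
Qed.

(** Serves to split off the direction c: the rows of [dsubmx H] are an orthonormal basis of its
    orthogonal complement. *)
Lemma orthogonal_completion n (c : 'rV[R]_(1 + n)) : sqn c = 1 ->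
  exists2 H : 'M[R]_(1 + n), H *m H^T = 1%:M & usubmx H = c.
Proof.
move=> c1; pose e0 : 'rV[R]_(1 + n) := delta_mx 0 0.
have [->|ce0] := eqVneq c e0.
  exists 1%:M; first by rewrite trmx1 mulmx1.
  apply/matrixP => i j; rewrite !mxE ord1 eqxx /= [in RHS]eq_sym.
  by have -> : lshift n 0 = 0 :> 'I_(1 + n) by apply: val_inj.
pose v := c - e0; pose q := sqn v.
have q0 : q != 0 by rewrite sqn_eq0 subr_eq0.
have qE : q = 2 - 2 * c 0 0.
  rewrite /q /sqn big_ord_recl /=.
  have -> : 2 - 2 * c 0 0 = sqn c + (1 - 2 * c 0 0) by rewrite c1; ring.
  rewrite /sqn (big_ord_recl n (fun i => c 0 i ^+ 2)).
  rewrite (eq_bigr (fun i => c 0 (lift ord0 i) ^+ 2)).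
    by rewrite /v /e0 !mxE /=; ring.
  by move=> i _; rewrite /v /e0 !mxE /= subr0.
(* H is the Householder reflection that exchanges e0 and c. *)
pose H := 1%:M - (2 / q) *: (v^T *m v).
have HT : H^T = H by rewrite /H linearB /= linearZ /= trmx_mul trmxK trmx1.
have vv : v^T *m v *m (v^T *m v) = q *: (v^T *m v).
  by rewrite mulmxA -(mulmxA v^T) sqnE -/q mul_mx_scalar -scalemxAl.
exists H.
  rewrite HT /H; move: (v^T *m v) vv => V vv.
  rewrite mulmxBl mul1mx mulmxBr mulmx1 -!scalemxAl -!scalemxAr vv.
  apply/matrixP => i j; rewrite !mxE.
  by field.
have -> : usubmx H = e0 *m H.
  apply/matrixP => i j; rewrite ord1 -rowE !mxE.
  by have -> : lshift n 0 = 0 :> 'I_(1 + n) by apply: val_inj.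
have ev : e0 *m v^T = (c 0 0 - 1)%:M.
  apply/matrixP => i j; rewrite !ord1 -rowE !mxE /=.
  by rewrite mulr1n.
rewrite /H mulmxBr mulmx1 -scalemxAr mulmxA ev mul_scalar_mx scalerA.
have -> : 2 / q * (c 0 0 - 1) = -1.
  have -> : c 0 0 - 1 = - q / 2 by rewrite qE; field.
  by field.
by rewrite scaleN1r opprK /v addrC subrK.
Qed.

End SqNorm.

(** Cramer's rule: expand along row i, whose cofactors are those of A and form a column of the
    adjugate. *)
Lemma det_replace_row (R : comUnitRingType) n (A : 'M[R]_n) (c : 'rV[R]_n) i :
  \det (\matrix_(k, j) if k == i then (c *m A) 0 j else A k j) =
  c 0 i * \det A.
Proof.
set B := \matrix_(_, _) _.
rewrite (expand_det_row B i).
have cof j : cofactor B i j = \adj A j i.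
  rewrite mxE /cofactor; congr (_ * \det _).
  by apply/matrixP => k l; rewrite !mxE eq_sym (negbTE (neq_lift _ _)).
under eq_bigr do rewrite cof mxE eqxx.
have -> : \sum_j (c *m A) 0 j * \adj A j i = (c *m A *m \adj A) 0 i.
  by rewrite [RHS]mxE.
by rewrite -mulmxA mul_mx_adj mul_mx_scalar mxE mulrC.
Qed.

Section DvoretzkyRogers.
Context (R : realType) (X : normedModType R).

(** The operator from l_2^N to X that maps the standard basis to w. *)
Definition comb N (w : 'I_N -> X) (c : 'rV[R]_N) : X := \sum_i c 0 i *: w i.

Lemma comb0 N (w : 'I_N -> X) : comb w 0 = 0.
Proof. by rewrite /comb big1 // => i _; rewrite mxE scale0r. Qed.

Lemma combZ N (w : 'I_N -> X) a c : comb w (a *: c) = a *: comb w c.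
Proof.
by rewrite /comb scaler_sumr; apply: eq_bigr => i _; rewrite mxE scalerA.
Qed.

Lemma comb_mulmx N M (w : 'I_N -> X) (c : 'rV[R]_M) (U : 'M[R]_(M, N)) :
  comb w (c *m U) = \sum_i c 0 i *: comb w (row i U).
Proof.
rewrite /comb (eq_bigr (fun j => \sum_i (c 0 i * U i j) *: w j)); last first.
  by move=> j _; rewrite mxE scaler_suml.
rewrite exchange_big /=; apply: eq_bigr => i _.
by rewrite scaler_sumr; apply: eq_bigr => j _; rewrite mxE scalerA.
Qed.

(* While some unit vector c of the row space of U is stretched by more than t,
   keep c and continue in its orthogonal complement. *)
Lemma greedy_orthonormal N (w : 'I_N -> X) (t : R) (m n : nat)
    (U : 'M[R]_(m + n, N)) :
  0 <= t -> U *m U^T = 1%:M ->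
  (exists2 V : 'M[R]_(n, N), V *m V^T = 1%:M &
     forall c, `|comb w (c *m V)| ^+ 2 <= t ^+ 2 * sqn c) \/
  (exists2 F : 'M[R]_(m, m + n), F *m F^T = 1%:M &
     forall i, t < `|comb w (row i (F *m U))|).
Proof.
move=> t0; elim: m U => [|m IH] U UU.
  by right; exists 0; [by apply/matrixP; case|by case].
have [small|] := pselect (forall c, `|comb w (c *m U)| ^+ 2 <= t ^+ 2 * sqn c).
  (* The bound holds on the whole row space of U, hence on the span of any n of its rows. *)
  left; exists (dsubmx U).
    have := UU; rewrite -{1 2}(vsubmxK U) tr_col_mx mul_col_row.
    by rewrite (scalar_mx_block _ _ 1) => /eq_block_mx[].
  move=> c; have := small (row_mx 0 c).
  rewrite -{1}(vsubmxK U) mul_row_col mul0mx add0r => /le_trans; apply.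
  by rewrite /sqn big_split_ord /= [X in X + _]big1 ?add0r => [|i _];
    rewrite ?row_mxEl ?mxE ?expr0n //=;
    under eq_bigr do rewrite row_mxEr.
move=> /existsNP[c0 /negP]; rewrite -ltNge => c0big.
have c0n : 0 < sqn c0.
  rewrite lt_def sqn_ge0 andbT sqn_eq0; apply/eqP => c00.
  move: c0big; rewrite c00 mul0mx.
  have -> : sqn (0 : 'rV[R]_(m.+1 + n)) = 0 by apply/eqP; rewrite sqn_eq0.
  by rewrite mulr0 comb0 normr0 expr0n /= ltxx.
pose c : 'rV[R]_(1 + (m + n)) := (Num.sqrt (sqn c0))^-1 *: c0.
have c1 : sqn c = 1.
  by rewrite sqnZ exprVn sqr_sqrtr ?sqn_ge0// mulVf// gt_eqF.
have cbig : t < `|comb w (c *m (U : 'M[R]_(1 + (m + n), N)))|.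
  rewrite -(@ltr_pXn2r _ 2)// ?nnegrE//.
  rewrite /c -scalemxAl combZ normrZ exprMn ger0_norm ?invr_ge0 ?sqrtr_ge0//.
  by rewrite exprVn sqr_sqrtr ?sqn_ge0// mulrC ltr_pdivlMr.
have [H HH Hc] := orthogonal_completion c1.
move: HH; rewrite -{1 2}(vsubmxK H) Hc tr_col_mx mul_col_row.
rewrite (scalar_mx_block _ _ 1) => /eq_block_mx[cc cH Hct HHl].
(* [U2] represents the orthogonal complement of [c *m U] inside the row space of U. *)
pose U2 : 'M[R]_(m + n, N) := dsubmx H *m (U : 'M[R]_(1 + (m + n), N)).
have U2U : U2 *m U2^T = 1%:M.
  by rewrite /U2 trmx_mul mulmxA -(mulmxA _ U) UU mulmx1 HHl.
have [[V VV Vs]|[F FF Fs]] := IH U2 U2U; first by left; exists V.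
pose G : 'M[R]_(1 + m, 1 + (m + n)) := col_mx c (F *m dsubmx H).
have GG : G *m G^T = 1%:M.
  rewrite /G tr_col_mx mul_col_row cc trmx_mul !mulmxA cH mul0mx.
  rewrite -(mulmxA F) Hct mulmx0 -(mulmxA F) HHl mulmx1 FF.
  by rewrite -scalar_mx_block.
have rowG0 (j : 'I_1) : row (lshift m j) G = c.
  by rewrite /G rowKu [j]ord1 row_id.
have rowG1 (j : 'I_m) : row (rshift 1 j) G = row j F *m dsubmx H.
  by rewrite /G rowKd row_mul.
right; exists G => // i; rewrite row_mul.
case: (@splitP 1 m i) => j ij.
  by rewrite (_ : i = lshift m j) ?rowG0//; apply: val_inj.
rewrite (_ : i = rshift 1 j) ?rowG1; last exact: val_inj.
by rewrite -mulmxA -row_mul; exact: Fs.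
Qed.

Lemma free_family : ~ finite_dimensional X ->
  forall N, exists w : 'I_N -> X, forall c, comb w c = 0 -> c = 0.
Proof.
move=> infX; elim=> [|N [w wfree]].
  by exists (fun=> 0) => c _; apply/rowP; case.
have [x xw] : exists x, forall c : 'I_N -> R, x <> \sum_(i < N) c i *: w i.
  apply: contrapT => /forallNP H; apply: infX; exists N, w => x.
  by apply: contrapT => /forallNP H1; exact: H H1.
exists (fun i => if unlift ord0 i is Some j then w j else x) => c.
rewrite /comb big_ord_recl unlift_none /=.
under eq_bigr do rewrite liftK.
have [c0|c0] := eqVneq (c 0 0) 0.
  rewrite c0 scale0r add0r => cw.
  have := wfree (\row_i c 0 (lift ord0 i)).
  rewrite /comb; under eq_bigr do rewrite mxE.
  move=> /(_ cw) /rowP z; apply/rowP => i; rewrite mxE.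
  case: (unliftP ord0 i) => [j|] -> //.
  by have := z j; rewrite !mxE.
move=> /eqP; rewrite addr_eq0 => /eqP H; exfalso.
apply: (xw (fun i => - (c 0 0)^-1 * c 0 (lift ord0 i))).
rewrite -[LHS]scale1r -(mulVf c0) -scalerA H scalerN -scaleNr scaler_sumr.
by apply: eq_bigr => i _; rewrite scalerA.
Qed.

Lemma le_coord_norm N (c : 'rV[R]_N.+1) i : `|c 0 i| <= `|c|.
Proof.
rewrite [leRHS]mx_normrE.
exact: (le_bigmax _ (fun ij : 'I_1 * 'I_N.+1 => `|c ij.1 ij.2|) (0, i)).
Qed.

(** By compactness of the unit sphere of the sup norm, the norm of [comb w c] has a minimum there,
    which is positive because w is free. *)
Lemma free_lower_bound N (w : 'I_N -> X) :
  (forall c, comb w c = 0 -> c = 0) ->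
  exists2 a : R, 0 < a &
    forall (c : 'rV[R]_N) (i : 'I_N), a * `|c 0 i| <= `|comb w c|.
Proof.
case: N w => [|N] w wfree; first by exists 1 => // c [].
pose A := [set c : 'rV[R]_N.+1 | `|c| = 1].
have ccomb : continuous (comb w).
  apply: continuous_big => [|i _ c]; first exact: add_continuous.
  apply: (@cvgZr_tmp _ _ _ (nbhs c) _ (fun x : 'rV[R]_N.+1 => x 0 i)).
  exact: coord_continuous.
have cnorm : continuous (fun c : 'rV[R]_N.+1 => `|comb w c|).
  move=> c; apply: (@continuous_comp _ _ _ (comb w) Num.norm).
    exact: ccomb.
  exact: norm_continuous.
have normA (d : 'rV[R]_N.+1) : d != 0 -> A (`|d|^-1 *: d).
  move=> d0; rewrite /A /= normrZ ger0_norm ?invr_ge0// mulVf//.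
  by rewrite normr_eq0.
have A0 : A !=set0.
  pose o : 'rV[R]_N.+1 := const_mx 1; exists (`|o|^-1 *: o); apply: normA.
  by apply/eqP => /matrixP /(_ 0 0)/eqP; rewrite !mxE oner_eq0.
have cA : compact A.
  apply: bounded_closed_compact.
    exists 1; split; first exact: num_real.
    by move=> x x1 c; rewrite /A /= => ->; exact: ltW.
  apply: (@closed_comp _ _ (Num.norm : 'rV[R]_N.+1 -> R) [set x | x = 1]).
    by move=> x _; exact: norm_continuous.
  exact: closed_eq.
have [c /set_mem cA' cmin] := EVT_min_rV A0 cA (continuous_subspaceT cnorm).
exists `|comb w c|.
  rewrite normr_gt0; apply: contra_eq_neq cA' => /eqP/eqP/wfree ->.
  by rewrite normr0 eq_sym oner_eq0.
move=> d i; have [->|d0] := eqVneq d 0.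
  by rewrite mxE normr0 mulr0.
have dgt : 0 < `|d| by rewrite normr_gt0.
apply: (@le_trans _ _ (`|comb w c| * `|d|)).
  by rewrite ler_wpM2l// le_coord_norm.
rewrite -ler_pdivlMr//; apply: (le_trans (cmin _ (mem_set (normA _ d0)))).
by rewrite combZ normrZ ger0_norm ?invr_ge0// mulrC.
Qed.

(** Auerbach's lemma with constant 2 in place of 1: among matrices whose rows give vectors of norm
    at most 1, one with more than half of the supremal determinant is enough, so the supremum need
    not be attained. *)
Lemma almost_auerbach N : ~ finite_dimensional X ->
  exists w : 'I_N -> X, (forall i, `|w i| <= 1) /\
    forall (c : 'rV[R]_N) (i : 'I_N), `|c 0 i| <= 2 * `|comb w c|.
Proof.
move=> infX; have [v vfree] := free_family infX N.
have [a a0 av] := free_lower_bound vfree.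
pose B := [set A : 'M[R]_N | forall i, `|comb v (row i A)| <= 1].
pose S := [set `|\det A| | A in B].
have S0 : exists2 s : R, S s & 0 < s.
  pose b : R := (1 + \sum_i `|v i|)^-1.
  have b1 : 0 < 1 + \sum_i `|v i|.
    by rewrite ltr_pwDl// sumr_ge0.
  have b0 : 0 < b by rewrite invr_gt0.
  exists (`|\det (b%:M : 'M[R]_N)|); last first.
    by rewrite det_scalar normr_gt0 expf_neq0// gt_eqF.
  exists b%:M => // i; rewrite /= (_ : row i b%:M = b *: delta_mx 0 i).
    rewrite combZ normrZ gtr0_norm// ler_pdivrMl// mulr1.
    rewrite /comb (bigD1 i)//= big1 ?addr0 => [|j ji]; last first.
      by rewrite mxE (negbTE ji) andbF scale0r.
    rewrite mxE !eqxx scale1r (bigD1 i)//= addrCA lerDl.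
    by rewrite addr_ge0// sumr_ge0.
  by apply/rowP => j; rewrite !mxE eqxx eq_sym mulr_natr.
(* By [free_lower_bound] each entry of A is at most a^-1, which bounds every term of the Leibniz
   formula. *)
have ubS : ubound S (\sum_(s : 'S_N) a^-1 ^+ N).
  move=> _ [A BA <-]; rewrite /determinant.
  apply: (le_trans (ler_norm_sum _ _ _)); apply: ler_sum => s _.
  rewrite normrM normrX normrN normr1 expr1n mul1r normr_prod.
  rewrite -[X in _ ^+ X]card_ord -prodr_const; apply: ler_prod => i _.
  rewrite normr_ge0/= -[leRHS]mul1r ler_pdivlMr// mulrC.
  have := av (row i A) (s i); rewrite mxE => /le_trans; apply; exact: BA.
have supS : has_sup S by split; [case: S0 => s; exists s|eexists; exact: ubS].
have s0 : 0 < sup S.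
  by case: S0 => s Ss s0; apply: (lt_le_trans s0); exact: sup_upper_bound.
(* By Cramer's rule, replacing row i of A by the coordinates of a normalized
   vector multiplies the determinant by its i-th coordinate. *)
have [_ [A BA <-]] := @sup_adherent _ S (sup S / 2) ltac:(by rewrite divr_gt0) supS.
have -> : sup S - sup S / 2 = sup S / 2 by field.
move=> As.
have dA : \det A != 0.
  by rewrite -normr_gt0 (lt_trans _ As)// divr_gt0.
exists (fun i => comb v (row i A)); split=> // c i.
rewrite [X in _ <= 2 * `|X|](_ : _ = comb v (c *m A)); last by rewrite comb_mulmx.
set x := comb v (c *m A).
have [x0|x0] := eqVneq x 0.
  have cA := vfree _ x0.
  have -> : c = 0.
    have AU : A \in unitmx by rewrite unitmxE unitfE.
    by rewrite -(mulmxK AU c) cA mul0mx.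
  by rewrite mxE normr0 mulr_ge0.
have xgt : 0 < `|x| by rewrite normr_gt0.
pose A' := \matrix_(k, j) if k == i then ((`|x|^-1 *: c) *m A) 0 j else A k j.
have SA' : S `|\det A'|.
  exists A' => // k /=; have [->|ki] := eqVneq k i.
    rewrite (_ : row i A' = `|x|^-1 *: (c *m A)).
      by rewrite combZ normrZ ger0_norm ?invr_ge0// mulVf// gt_eqF.
    by apply/rowP => j; rewrite [LHS]mxE [LHS]mxE eqxx -scalemxAl.
  rewrite (_ : row k A' = row k A); first exact: BA.
  by apply/rowP => j; rewrite [LHS]mxE [LHS]mxE (negbTE ki) mxE.
have := sup_upper_bound supS SA'.
rewrite /A' det_replace_row mxE !normrM ger0_norm ?invr_ge0// => dle.
have : `|x|^-1 * `|c 0 i| * `|\det A| <= 2 * `|\det A|.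
  by apply: (le_trans dle); lra.
rewrite ler_pM2r ?normr_gt0// ler_pdivrMl//. by rewrite mulrC.
Qed.

Lemma dvoretzky_rogers m (t : R) : ~ finite_dimensional X -> 0 < t < 1 ->
  exists e : 'I_m -> X, (forall i, t < `|e i|) /\
    forall c, `|comb e c| ^+ 2 <= sqn c.
Proof.
(* Otherwise every operator from l_2^N shrinks by a factor t ^+ k on a subspace of
   codimension k * m, but the one given by almost_auerbach is bounded below by a
   power of N^-1. *)
move=> infX /andP[t0 t1]; apply: contrapT => noe.
(* Here L bounds the operator on the row space of U. If the greedy search found m orthonormal
   vectors stretched by more than L t, their images divided by L would be the family excluded by
   [noe]. *)
have iterate N (w : 'I_N -> X) (L : R) n k
    (U : 'M[R]_(iter k (addn m) n, N)) : 0 < L -> U *m U^T = 1%:M ->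
    (forall c, `|comb w (c *m U)| ^+ 2 <= L ^+ 2 * sqn c) ->
    exists2 V : 'M[R]_(n, N), V *m V^T = 1%:M &
      forall c, `|comb w (c *m V)| ^+ 2 <= (L * t ^+ k) ^+ 2 * sqn c.
  elim: k L U => [|k IH] L U L0 UU Ub; first by exists U; rewrite ?mulr1.
  have [|[V VV Vb]|[F FF Fb]] := @greedy_orthonormal _ w (L * t) m _ U _ UU.
  - by rewrite mulr_ge0// ltW.
  - have [|W WW Wb] := IH _ V _ VV Vb; first by rewrite mulr_gt0.
    by exists W => // c; rewrite [t ^+ k.+1]exprS mulrA.
  exfalso; apply: noe.
  exists (fun i => L^-1 *: comb w (row i (F *m U))); split=> [i|c].
    by rewrite normrZ gtr0_norm ?invr_gt0// ltr_pdivlMl.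
  have -> : comb (fun i => L^-1 *: comb w (row i (F *m U))) c =
      L^-1 *: comb w (c *m F *m U).
    rewrite -mulmxA comb_mulmx scaler_sumr; apply: eq_bigr => i _.
    by rewrite scalerA mulrC -scalerA.
  rewrite normrZ exprMn gtr0_norm ?invr_gt0// exprVn ler_pdivrMl ?exprn_gt0//.
  by rewrite (le_trans (Ub _))// sqn_mulmx.
(* From dimension N = k m + 1, k rounds leave one unit vector V with |comb w V| <= N t^k, whereas
   the lower bound on w gives 1 <= 4 N |comb w V|^2. *)
have bound k : 1 <= 4 * (k * m).+1%:R ^+ 3 * (t ^+ 2) ^+ k :> R.
  set N := iter k (addn m) 1.
  have NE : N = (k * m).+1.
    by rewrite /N; elim: (k) => //= j ->; rewrite mulSn addnS.
  have [w [w1 wc]] := almost_auerbach N infX.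
  have N0 : 0 < N%:R :> R by rewrite ltr0n NE.
  have [||V VV Vb] := iterate N w N%:R 1 k 1%:M N0.
  - by rewrite trmx1 mulmx1.
  - move=> c; rewrite mulmx1 -(sqr_sqrtr (sqn_ge0 c)) -exprMn.
    rewrite lerXn2r ?nnegrE ?mulr_ge0 ?sqrtr_ge0//.
    apply: (le_trans (ler_norm_sum _ _ _)).
    rewrite mulr_natl -[X in _ *+ X]card_ord -sumr_const.
    apply: ler_sum => i _; rewrite normrZ.
    apply: (@le_trans _ _ `|c 0 i|); first by rewrite ler_piMr.
    rewrite -sqrtr_sqr ler_wsqrtr// /sqn (bigD1 i)//= lerDl.
    by apply: sumr_ge0 => j _; exact: sqr_ge0.
  have := Vb 1%:M; rewrite mul1mx => Vt.
  have I1 : sqn (1%:M : 'rV[R]_1) = 1 by rewrite /sqn big_ord1 mxE eqxx expr1n.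
  have V1 : sqn V = 1 by rewrite -(mul1mx V) sqn_mulmx.
  have : sqn V <= N%:R * (4 * `|comb w V| ^+ 2).
    rewrite mulr_natl -[X in _ *+ X]card_ord -sumr_const.
    apply: ler_sum => i _; rewrite -real_normK ?num_real//.
    rewrite (_ : 4 = 2 ^+ 2 :> R); last by rewrite -natrX.
    rewrite -exprMn.
    by rewrite lerXn2r ?nnegrE ?mulr_ge0//; exact: wc.
  rewrite V1 => /le_trans; apply.
  rewrite I1 mulr1 in Vt; rewrite -NE.
  rewrite exprAC.
  have -> : 4 * N%:R ^+ 3 * (t ^+ k) ^+ 2 = N%:R * (4 * (N%:R * t ^+ k) ^+ 2).
    by move=> {Vt}; ring.
  by rewrite !ler_wpM2l.
pose h := (t ^+ 2)^-1 - 1.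
have t2 : 0 < t ^+ 2 by rewrite exprn_gt0.
have h0 : 0 < h.
  by rewrite subr_gt0 invf_gt1// expr_lt1// ltW.
have bern j : j%:R * h <= (t ^+ 2)^-1 ^+ j.
  have -> : (t ^+ 2)^-1 = 1 + h by rewrite /h addrC subrK.
  apply: (@le_trans _ _ (1 + j%:R * h)); first by rewrite lerDr.
  elim: j => [|j IH]; first by rewrite mul0r addr0 expr0.
  rewrite exprSr; have : (1 + j%:R * h) * (1 + h) <= (1 + h) ^+ j * (1 + h).
    by rewrite ler_wpM2r// addr_ge0// ltW.
  apply: le_trans; rewrite -natr1.
  have : 0 <= j%:R * h ^+ 2 by rewrite mulr_ge0// sqr_ge0.
  by lra.
pose C : R := 4 * (4 * m + 1)%:R ^+ 3.
(* For k = 4 j, the fourth power of the Bernoulli bound t^(-2j) >= j h outgrows the cubic factor in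
   [bound]. *)
have lin j : (0 < j)%N -> j%:R * h ^+ 4 <= C.
  move=> j0; have jp : 0 < j%:R :> R by rewrite ltr0n.
  have := bound (4 * j)%N.
  have -> : (t ^+ 2) ^+ (4 * j) = (((t ^+ 2)^-1 ^+ j) ^+ 4)^-1.
    by rewrite !exprVn invrK (mulnC 4) exprM.
  have q0 : 0 < ((t ^+ 2)^-1 ^+ j) ^+ 4 by rewrite !exprn_gt0// invr_gt0.
  rewrite ler_pdivlMr// mul1r => b.
  have jh : (j%:R * h) ^+ 4 <= 4 * (j%:R * (4 * m + 1)%:R) ^+ 3.
    apply: (le_trans _ (le_trans b _)).
      apply: lerXn2r (bern j); rewrite nnegrE; first by rewrite mulr_ge0// ltW.
      by rewrite exprn_ge0// invr_ge0 ltW.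
    rewrite ler_wpM2l// lerXn2r ?nnegrE ?mulr_ge0// -natrM ler_nat.
    by rewrite mulnDr muln1 mulnCA -mulnA -[leqLHS]addn1 leq_add2l.
  rewrite -(@ler_pM2l _ (j%:R ^+ 3)) ?exprn_gt0// /C.
  by move: jh; rewrite !exprMn; lra.
have C0 : 0 <= C / h ^+ 4 by rewrite divr_ge0 ?mulr_ge0 ?exprn_ge0// ltW.
have := archi_boundP C0; set j := Num.bound _ => Cj.
have := lin j.+1 isT; apply/negP; rewrite -ltNge -ltr_pdivrMr ?exprn_gt0//.
by apply: (lt_trans Cj); rewrite ltr_nat.
Qed.

End DvoretzkyRogers.

(** * A Lipschitz map prescribed on rays *)

Section RayDist.
Context (R : realType) (X : normedModType R).
Implicit Types e x y : X.

Definition raydist e x : R := inf [set `|x - t *: e| | t in [set t : R | 0 <= t]].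

Lemma raydist_ge e x r : (forall t : R, 0 <= t -> r <= `|x - t *: e|) -> r <= raydist e x.
Proof.
move=> H; apply: lb_le_inf; first by exists `|x - 0 *: e|, 0 => //=.
by move=> _ [t t0 <-]; exact: H.
Qed.

Lemma raydist_le e x t : 0 <= t -> raydist e x <= `|x - t *: e|.
Proof.
move=> t0; apply: ge_inf; last by exists t.
by exists 0 => _ [s _ <-].
Qed.

Lemma raydist_lip e x y : raydist e x - `|x - y| <= raydist e y.
Proof.
apply: raydist_ge => t t0; rewrite lerBlDr; apply: (le_trans (raydist_le _ _ t0)).
rewrite (_ : x - t *: e = (y - t *: e) + (x - y)) ?ler_normD//.
by rewrite [RHS]addrC addrA subrK.
Qed.

Lemma ler_raydistZ a e x : 0 < a -> a * raydist e x <= raydist e (a *: x).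
Proof.
move=> a0; apply: raydist_ge => t t0.
rewrite -ler_pdivlMl//.
rewrite (_ : a^-1 * `|a *: x - t *: e| = `|x - (a^-1 * t) *: e|).
  by apply: raydist_le; rewrite mulr_ge0// invr_ge0 ltW.
rewrite -(gtr0_norm (_ : 0 < a^-1)) ?invr_gt0// -normrZ scalerBr !scalerA.
by rewrite gtr0_norm ?invr_gt0// mulVf ?scale1r// gt_eqF.
Qed.

Lemma raydistZ a e x : 0 < a -> raydist e (a *: x) = a * raydist e x.
Proof.
move=> a0; apply/eqP; rewrite eq_le ler_raydistZ// andbT -ler_pdivrMl//.
rewrite (le_trans (ler_raydistZ _ _ _)) ?invr_gt0// scalerA mulVf ?scale1r//.
by rewrite gt_eqF.
Qed.

Variables (m : nat) (e : 'I_m -> X).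

(* The default value `|x| is at least every raydist (e i) x, so it only matters
   when there is no other ray. *)
Definition other_raydist (j : 'I_m) x : R :=
  \big[Num.min/`|x|]_(i | i != j) raydist (e i) x.

Lemma other_raydist_lip j x y :
  other_raydist j x - `|x - y| <= other_raydist j y.
Proof.
apply/bigmin_geP; split=> [|i ij].
  rewrite lerBlDr (le_trans (bigmin_le_id _ _ _ _))//.
  by rewrite -{1}(subrK y x) addrC ler_normD.
apply: le_trans (raydist_lip (e i) x y); rewrite lerB//.
exact: bigmin_le_cond.
Qed.

Lemma ler_other_raydistZ a j x : 0 < a ->
  a * other_raydist j x <= other_raydist j (a *: x).
Proof.
move=> a0; apply/bigmin_geP; split=> [|i ij].
  by rewrite normrZ gtr0_norm// ler_pM2l// bigmin_le_id.
by rewrite raydistZ// ler_pM2l//; exact: bigmin_le_cond.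
Qed.

Lemma other_raydistZ a j x : 0 < a ->
  other_raydist j (a *: x) = a * other_raydist j x.
Proof.
move=> a0; apply/eqP; rewrite eq_le ler_other_raydistZ// andbT -ler_pdivrMl//.
rewrite (le_trans (ler_other_raydistZ _ _ _)) ?invr_gt0// scalerA mulVf ?scale1r//.
by rewrite gt_eqF.
Qed.

(** Positive exactly at the points closer to ray j than to every other ray ([other_raydist]); these
    open cones are pairwise disjoint. *)
Definition cone_bump j x : R :=
  Num.max 0 (other_raydist j x - raydist (e j) x).

Lemma cone_bump_ge0 j x : 0 <= cone_bump j x.
Proof. by rewrite le_max lexx. Qed.

Lemma cone_bumpZ a j x : 0 < a -> cone_bump j (a *: x) = a * cone_bump j x.
Proof.
move=> a0; rewrite /cone_bump raydistZ// other_raydistZ// -mulrBr.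
by rewrite maxr_pMr ?mulr0// ltW.
Qed.

Lemma cone_bump_lip j x y : cone_bump j x - cone_bump j y <= 2 * `|x - y|.
Proof.
rewrite lerBlDr ge_max addr_ge0 ?mulr_ge0 ?cone_bump_ge0//=.
have h1 := other_raydist_lip j x y; have h2 := raydist_lip (e j) y x.
have h3 : other_raydist j y - raydist (e j) y <= cone_bump j y.
  by rewrite le_max lexx orbT.
by rewrite distrC in h2; lra.
Qed.

(** Involves only two distances. For x in cone i and y in cone j, adding this bound at x to the
    symmetric one at y leaves the increments of two 1-Lipschitz functions, so that [cone_map] has
    constant 2 across cones and not 4. *)
Lemma cone_bump_gt0 i j x : i != j -> 0 < cone_bump i x ->
  cone_bump i x <= raydist (e j) x - raydist (e i) x.
Proof.
move=> ij; rewrite /cone_bump; case: (leP 0 (other_raydist i x - _)); last first.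
  by rewrite ltxx.
by move=> _ _; rewrite lerB// bigmin_le_cond// eq_sym.
Qed.

Lemma cone_bump_disjoint i j x : i != j -> 0 < cone_bump i x -> cone_bump j x = 0.
Proof.
move=> ij i0; apply/eqP; rewrite -[_ == _]negbK; apply/negP => j0.
have {}j0 : 0 < cone_bump j x by rewrite lt_def j0 cone_bump_ge0.
have := cone_bump_gt0 ij i0; have := cone_bump_gt0 (_ : j != i) j0.
by rewrite eq_sym => /(_ ij); lra.
Qed.

Variables (Y : normedModType R) (u : 'I_m -> Y).
Hypothesis u1 : forall j, `|u j| <= 1.

Definition cone_map x : Y := \sum_j cone_bump j x *: u j.

Lemma cone_map_active i x : 0 < cone_bump i x -> cone_map x = cone_bump i x *: u i.
Proof.
move=> i0; rewrite /cone_map (bigD1 i)//= big1 ?addr0// => j ji.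
by rewrite (cone_bump_disjoint _ i0) ?scale0r// eq_sym.
Qed.

Lemma cone_map_inactive x : (forall i, ~ 0 < cone_bump i x) -> cone_map x = 0.
Proof.
move=> H; rewrite /cone_map big1// => i _.
have := H i; rewrite lt_def cone_bump_ge0 andbT => /negP; rewrite negbK => /eqP ->.
by rewrite scale0r.
Qed.

Lemma cone_map_lip x y : `|cone_map x - cone_map y| <= 2 * `|x - y|.
Proof.
have bumpu i (r : R) : `|r *: u i| <= `|r| by rewrite normrZ ler_piMr.
have one z w i : 0 < cone_bump i z -> ~ 0 < cone_bump i w ->
    `|cone_bump i z *: u i| <= 2 * `|z - w|.
  move=> iz iw; apply: (le_trans (bumpu _ _)); rewrite gtr0_norm//.
  apply: le_trans (cone_bump_lip i z w); rewrite lerBrDr gerDl.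
  by rewrite leNgt; apply/negP.
have [[i ix]|nx] := pselect (exists i, 0 < cone_bump i x);
  have [[k ky]|ny] := pselect (exists i, 0 < cone_bump i y).
- have [ik|ik] := eqVneq i k.
    subst k; rewrite !(@cone_map_active i)// -scalerBl.
    apply: (le_trans (bumpu _ _)); rewrite ler_norml.
    have := cone_bump_lip i x y; have := cone_bump_lip i y x.
    by rewrite distrC => h1 h2; apply/andP; split; lra.
  rewrite (cone_map_active ix) (cone_map_active ky).
  apply: (le_trans (ler_normB _ _)).
  apply: (le_trans (lerD (bumpu _ _) (bumpu _ _))).
  rewrite !gtr0_norm//.
  have h1 := cone_bump_gt0 ik ix; rewrite eq_sym in ik.
  have h2 := cone_bump_gt0 ik ky.
  have h3 := raydist_lip (e k) x y; have h4 := raydist_lip (e i) y x.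
  by rewrite distrC in h4; lra.
- rewrite (cone_map_active ix) cone_map_inactive ?subr0; last exact/forallNP.
  by apply: one => // iy; apply: ny; exists i.
- rewrite (cone_map_active ky) (@cone_map_inactive x); last exact/forallNP.
  by rewrite sub0r normrN distrC; apply: one => // kx; apply: nx; exists k.
- by rewrite !cone_map_inactive ?subrr ?normr0 ?mulr_ge0//; exact/forallNP.
Qed.

Lemma cone_map0 : cone_map 0 = 0.
Proof.
apply: cone_map_inactive => i; apply/negP; rewrite -leNgt ge_max lexx /= subr_le0.
apply: (@le_trans _ _ 0); last by apply: raydist_ge.
by rewrite (le_trans (bigmin_le_id _ _ _ _))// normr0.
Qed.

(** At e_j the distance to its own ray is 0 and to the others at least r, so the bump is at least r;
    homogeneity extends this along the ray. The bound on the norm of e_j handles the default value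
    of [other_raydist]. *)
Lemma cone_map_ray (r : R) : 0 < r -> (forall j, r <= `|e j|) ->
  (forall i j t, i != j -> 0 <= t -> r <= `|e j - t *: e i|) ->
  forall j, exists2 s, r <= s &
    forall a, 0 < a -> cone_map (a *: e j) = (a * s) *: u j.
Proof.
move=> r0 re ree j.
have bump_ge : r <= cone_bump j (e j).
  rewrite le_max; apply/orP; right; rewrite lerBrDl -[leRHS]add0r.
  apply: lerD.
    by rewrite (le_trans (raydist_le _ _ ler01))// scale1r subrr normr0.
  apply/bigmin_geP; split=> // i ij.
  by apply: raydist_ge => t t0; exact: ree.
exists (cone_bump j (e j)) => // a a0.
have act : 0 < cone_bump j (a *: e j).
  by rewrite cone_bumpZ// mulr_gt0// (lt_le_trans r0).
by rewrite (cone_map_active act) cone_bumpZ.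
Qed.

End RayDist.

(** * Separation of the Dvoretzky-Rogers rays and the prescribed map *)

Section Prescription.
Context (R : realType) (X Y : normedModType R).

(* The constant 53 / 100 is chosen so that 2 / (53 / 100) < 1 + 2 * sqrt 2. *)
Lemma comb_ray_separation m (e : 'I_m -> X) :
  (forall i, 31 / 32 < `|e i|) -> (forall c, `|comb e c| ^+ 2 <= sqn c) ->
  forall i j (t : R), i != j -> 0 <= t -> 53 / 100 <= `|e j - t *: e i|.
Proof.
move=> elow eup i j t ij t0.
have pair (a b : R) : `|a *: e j + b *: e i| ^+ 2 <= a ^+ 2 + b ^+ 2.
  have := eup (a *: delta_mx 0 j + b *: delta_mx 0 i).
  rewrite /comb /sqn (bigD1 j)//= (bigD1 i)//= big1 => [|k /andP[kj ki]]; last first.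
    by rewrite !mxE (negbTE kj) (negbTE ki) !andbF !mulr0 addr0 scale0r.
  rewrite (bigD1 j)//= (bigD1 i)//= [X in _ <= _ + (_ + X)]big1 => [|k /andP[kj ki]];
      last first.
    by rewrite !mxE (negbTE kj) (negbTE ki) !andbF !mulr0 addr0 expr0n.
  by rewrite !mxE !eqxx (negbTE ij) eq_sym (negbTE ij) /= !mulr0 !mulr1 !addr0 !add0r.
have ej1 : `|e j| <= 1.
  have := pair 1 0; rewrite scale1r scale0r addr0 expr1n expr0n addr0.
  by rewrite expr_le1.
(* e j lies on the segment from e j - t *: e i to e j + 4^-1 *: e i, and the norm
   of the latter is close to 1. *)
have q : `|e j + 4^-1 *: e i| <= 33 / 32.
  rewrite -(@ler_pXn2r _ 2)// ?nnegrE//.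
  by have := pair 1 4^-1; rewrite scale1r => /le_trans; apply; lra.
have nZ (s : R) (v : X) : 0 <= s -> s * `|v| = `|s *: v|.
  by move=> s0; rewrite normrZ ger0_norm.
have h1 : (4^-1 + t) * `|e j| <=
    4^-1 * `|e j - t *: e i| + t * `|e j + 4^-1 *: e i|.
  have t4 : 0 <= 4^-1 + t by rewrite addr_ge0.
  rewrite !nZ//.
  apply: le_trans (ler_normD _ _).
  rewrite scalerBr scalerDr !scalerA (mulrC t) addrA scalerDl.
  by rewrite addrAC subrK addrC.
have h2 : t * `|e i| <= `|e j - t *: e i| + `|e j|.
  rewrite nZ// distrC -{1}(subrK (e j) (t *: e i)); exact: ler_normD.
have ei := elow i; have ej := elow j.
have h3 : t * (31 / 32) <= t * `|e i| by rewrite ler_wpM2l// ltW.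
have h4 : (4^-1 + t) * (31 / 32) <= (4^-1 + t) * `|e j|.
  by rewrite ler_wpM2l ?addr_ge0// ltW.
have h5 : t * `|e j + 4^-1 *: e i| <= t * (33 / 32) by rewrite ler_wpM2l.
(* For t <= 17/10 the convexity bound [h1] gives a distance of at least 31/32 - t/4; for larger t
   the triangle inequality [h2] gives at least 31 t/32 - 1. Both exceed 53/100. *)
by have [t17|t17] := leP t (17 / 10); lra.
Qed.

(** The factors s_j are the values of the bumps at e_j. They are only bounded below; the type 2
    estimate divides them out. *)
Lemma prescribed_lipschitz m (u : 'I_m -> Y) :
  ~ finite_dimensional X -> (forall j, `|u j| <= 1) ->
  exists (e : 'I_m -> X) (f : X -> Y) (s : 'I_m -> R),
    [/\ f 0 = 0, forall x y, `|f x - f y| <= 2 * `|x - y|,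
        forall j, 53 / 100 <= s j,
        forall c, `|comb e c| ^+ 2 <= sqn c &
        forall j a, 0 < a -> f (a *: e j) = (a * s j) *: u j].
Proof.
move=> infX u1.
have [|e [elow eup]] := @dvoretzky_rogers _ X m (31 / 32) infX; first by lra.
have r0 : 0 < 53 / 100 :> R by lra.
have re j : 53 / 100 <= `|e j| by apply: le_trans (ltW (elow j)); lra.
have H := cone_map_ray u r0 re (comb_ray_separation elow eup).
exists e, (cone_map e u), (fun j => sval (cid2 (H j))); split=> //.
- exact: cone_map0.
- exact: cone_map_lip.
- by move=> j; case: cid2.
- by move=> j a a0; case: cid2 => s /= _; apply.
Qed.

End Prescription.

(** * Rademacher averages *)

Section ProductWeights.
Context (R : realType) (I K : finType) (w : I -> K -> R).

(** The mass of c under the product of the laws [w i]; it expresses independent random colours as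
    finite sums. *)
Definition pweight (c : {ffun I -> K}) : R := \prod_i w i (c i).

Lemma pweight_ge0 c : (forall i k, 0 <= w i k) -> 0 <= pweight c.
Proof. by move=> w0; apply: prodr_ge0. Qed.

Hypothesis w1 : forall i, \sum_k w i k = 1.

Lemma sum_pweight : \sum_c pweight c = 1.
Proof.
rewrite -(bigA_distr_bigA w) /=; apply: big1 => i _; exact: w1.
Qed.

Lemma pweight_marginal (g : K -> R) i0 :
  \sum_c pweight c * g (c i0) = \sum_k w i0 k * g k.
Proof.
pose v i k := w i k * (if i == i0 then g k else 1).
transitivity (\sum_(c : {ffun I -> K}) \prod_i v i (c i)).
  apply: eq_bigr => c _; rewrite /v big_split/=; congr (_ * _).
  by rewrite (bigD1 i0)//= eqxx big1 ?mulr1// => i /negbTE ->.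
rewrite -(bigA_distr_bigA v) /= (bigD1 i0)//= [X in _ * X]big1 ?mulr1.
  by apply: eq_bigr => k _; rewrite /v eqxx.
by move=> i /negbTE ii0; under eq_bigr do rewrite /v ii0 mulr1.
Qed.

End ProductWeights.

(** The fibre of the coordinatewise map over b is a product of fibres of h, so its mass factorizes.
    Used to pass from a random colouring to the set of indices of one colour. *)
Lemma pweight_push (R : realType) (I K L : finType) (w : I -> K -> R) (h : K -> L)
    (F : {ffun I -> L} -> R) :
  \sum_c pweight w c * F [ffun i => h (c i)] =
  \sum_b pweight (fun i l => \sum_(k | h k == l) w i k) b * F b.
Proof.
rewrite (partition_big (fun c : {ffun I -> K} => [ffun i => h (c i)]) predT)//=.
apply: eq_bigr => b _.
rewrite (eq_bigr (fun c => pweight w c * F b)); last by move=> c /eqP ->.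
rewrite -mulr_suml; congr (_ * _).
rewrite /pweight (bigA_distr_big_dep (fun i k => h k == b i)) /=.
apply: eq_bigl => c; apply/eqP/forallP => /= [<- i|H].
  by rewrite unfold_in ffunE.
by apply/ffunP => i; rewrite ffunE; apply/eqP; exact: H.
Qed.

Section Rademacher.
Context (R : realType).

Definition rmean (I : finType) (f : {ffun I -> bool} -> R) : R :=
  2^-1 ^+ #|I| * \sum_e f e.

Lemma rmean_cst (I : finType) (a : R) : rmean (fun _ : {ffun I -> bool} => a) = a.
Proof.
rewrite /rmean sumr_const card_ffun card_bool -[in X in _ * X]mulr_natl mulrA.
by rewrite natrX -exprMn mulVf// expr1n mul1r.
Qed.

Lemma rmean_le (I : finType) (f g : {ffun I -> bool} -> R) :
  (forall e, f e <= g e) -> rmean f <= rmean g.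
Proof. by move=> fg; rewrite ler_wpM2l ?exprn_ge0 ?invr_ge0//; exact: ler_sum. Qed.

Lemma rmeanZ (I : finType) a (f : {ffun I -> bool} -> R) :
  rmean (fun e => a * f e) = a * rmean f.
Proof. by rewrite /rmean -mulr_sumr mulrCA. Qed.

Lemma rmeanD (I : finType) (f g : {ffun I -> bool} -> R) :
  rmean (fun e => f e + g e) = rmean f + rmean g.
Proof. by rewrite /rmean big_split/= mulrDr. Qed.

Lemma rmean_sum (I K : finType) (f : K -> {ffun I -> bool} -> R) :
  rmean (fun e => \sum_k f k e) = \sum_k rmean (f k).
Proof. by rewrite /rmean exchange_big/= mulr_sumr. Qed.

Lemma rmean_exchange (I J : finType) (f : {ffun I -> bool} -> {ffun J -> bool} -> R) :
  rmean (fun e => rmean (f e)) = rmean (fun d => rmean (f^~ d)).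
Proof.
rewrite /rmean -!mulr_sumr exchange_big/= mulrCA.
by congr (_ * (_ * _)).
Qed.

Lemma rmean_flip (I : finType) (d : {ffun I -> bool}) (f : {ffun I -> bool} -> R) :
  rmean (fun e => f [ffun i => d i (+) e i]) = rmean f.
Proof.
congr (_ * _).
rewrite [RHS](reindex_inj
  (h := fun e : {ffun I -> bool} => [ffun i => d i (+) e i]))//.
by move=> e e' /ffunP H; apply/ffunP => i; have := H i; rewrite !ffunE => /addbI.
Qed.

Context (V : normedModType R).

Lemma sqr_norm_convex (K : finType) (q : K -> R) (v : K -> V) :
  (forall k, 0 <= q k) -> \sum_k q k = 1 ->
  `|\sum_k q k *: v k| ^+ 2 <= \sum_k q k * `|v k| ^+ 2.
Proof.
move=> q0 q1; pose a := \sum_k q k * `|v k|.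
have na : `|\sum_k q k *: v k| <= a.
  apply: (le_trans (ler_norm_sum _ _ _)); apply: ler_sum => k _.
  by rewrite normrZ ger0_norm.
apply: (@le_trans _ _ (a ^+ 2)).
  by rewrite lerXn2r// nnegrE// sumr_ge0// => k _; rewrite mulr_ge0.
rewrite -subr_ge0.
(* The difference is the variance of the norms of the v_k under q. *)
have -> : \sum_k q k * `|v k| ^+ 2 - a ^+ 2 = \sum_k q k * (`|v k| - a) ^+ 2.
  rewrite [RHS](eq_bigr (fun k => q k * `|v k| ^+ 2 +
      ((- 2 * a) * (q k * `|v k|) + a ^+ 2 * q k))).
    by rewrite !big_split/= -!mulr_sumr q1 -/a; ring.
  by move=> k _; ring.
by apply: sumr_ge0 => k _; rewrite mulr_ge0// sqr_ge0.
Qed.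

Definition radavg (I : finType) (x : I -> V) : R :=
  rmean (fun e : {ffun I -> bool} => `|\sum_i (-1) ^+ e i *: x i| ^+ 2).

Lemma radavg_ge0 (I : finType) (x : I -> V) : 0 <= radavg x.
Proof.
by rewrite -(rmean_cst I 0); apply: rmean_le => e; exact: sqr_ge0.
Qed.

Lemma eq_radavg (I : finType) (x y : I -> V) : x =1 y -> radavg x = radavg y.
Proof. by move=> xy; congr radavg; exact: funext. Qed.

Lemma radavgZ (I : finType) a (x : I -> V) :
  radavg (fun i => a *: x i) = a ^+ 2 * radavg x.
Proof.
rewrite /radavg -rmeanZ; congr rmean; apply/funext => e.
rewrite -(real_normK (num_real a)) -exprMn -normrZ scaler_sumr; congr (`|_| ^+ 2).
by apply: eq_bigr => i _; rewrite !scalerA mulrC.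
Qed.

Lemma radavg_flip (I : finType) (d : {ffun I -> bool}) (x : I -> V) :
  radavg (fun i => (-1) ^+ d i *: x i) = radavg x.
Proof.
rewrite /radavg -[RHS](rmean_flip d); congr rmean; apply/funext => e.
congr (`|_| ^+ 2); apply: eq_bigr => i _.
by rewrite scalerA ffunE signr_addb mulrC.
Qed.

Lemma radavg_convex (I K : finType) (q : K -> R) (y : K -> I -> V) :
  (forall k, 0 <= q k) -> \sum_k q k = 1 ->
  radavg (fun i => \sum_k q k *: y k i) <= \sum_k q k * radavg (y k).
Proof.
move=> q0 q1; under eq_bigr do rewrite -rmeanZ.
rewrite -rmean_sum; apply: rmean_le => e.
apply: le_trans (sqr_norm_convex _ q0 q1).
rewrite le_eqVlt; apply/orP; left; apply/eqP; congr (`|_| ^+ 2).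
under eq_bigr do rewrite scaler_sumr.
rewrite exchange_big/=; apply: eq_bigr => k _; rewrite scaler_sumr.
by apply: eq_bigr => i _; rewrite !scalerA mulrC.
Qed.

Lemma radavg_contract (I : finType) (s : I -> R) (x : I -> V) :
  (forall i, `|s i| <= 1) -> radavg (fun i => s i *: x i) <= radavg x.
Proof.
move=> s1; pose w i (b : bool) : R := (1 + (-1) ^+ b * s i) / 2.
have wT i : \sum_b w i b = 1 by rewrite big_bool /w /= expr1 expr0; field.
have w0 i b : 0 <= w i b.
  rewrite /w divr_ge0//; have := s1 i; rewrite ler_norml => /andP[s1l s1r].
  by case: b; rewrite ?expr1 ?expr0; lra.
(* x i multiplied by s i is an average of sign changes of x i. *)
have := @radavg_convex I _ (pweight w) (fun d i => (-1) ^+ (d i) *: x i).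
move=> /(_ (fun c => pweight_ge0 c w0) (sum_pweight wT)).
rewrite (_ : (fun i => _) = (fun i => s i *: x i)); last first.
  apply/funext => i; under eq_bigr do rewrite scalerA.
  rewrite -scaler_suml (pweight_marginal wT (fun b : bool => (-1) ^+ b)).
  by congr (_ *: _); rewrite big_bool /w /= expr1 expr0; field.
under eq_bigr do rewrite radavg_flip.
by rewrite -mulr_suml sum_pweight// mul1r.
Qed.

Lemma radavg_monotone (I : finType) (s t : I -> R) (x : I -> V) :
  (forall i, `|s i| <= `|t i|) ->
  radavg (fun i => s i *: x i) <= radavg (fun i => t i *: x i).
Proof.
move=> st; pose r i := s i / t i.
rewrite (_ : (fun i => s i *: x i) = (fun i => r i *: (t i *: x i))).
  apply: radavg_contract => i; rewrite normrM normfV.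
  have [->|t0] := eqVneq (t i) 0; first by rewrite normr0 invr0 mulr0.
  by rewrite ler_pdivrMr ?normr_gt0// mul1r.
apply/funext => i; rewrite scalerA /r.
have [t0|t0] := eqVneq (t i) 0; last by rewrite divfK.
have := st i; rewrite t0 normr0 normr_le0 => /eqP ->.
by rewrite mulr0.
Qed.

Lemma radavgD (I : finType) (x y : I -> V) :
  radavg (fun i => x i + y i) <= 2 * radavg x + 2 * radavg y.
Proof.
rewrite -!rmeanZ -rmeanD; apply: rmean_le => e.
under eq_bigr do rewrite scalerDr.
rewrite big_split/=; set a := \sum_i _; set b := \sum_i _.
apply: (@le_trans _ _ ((`|a| + `|b|) ^+ 2)).
  by rewrite lerXn2r ?nnegrE ?addr_ge0// ler_normD.
by have := sqr_ge0 (`|a| - `|b|); rewrite !expr2; lra.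
Qed.

Lemma radavg_coord (I : finType) (x : I -> V) i : `|x i| ^+ 2 <= radavg x.
Proof.
have : radavg (fun k => (k == i)%:R *: x k) <= radavg x.
  by apply: radavg_contract => k; case: eqP; rewrite ?normr1 ?normr0.
rewrite /radavg (_ : (fun e => _) = fun=> `|x i| ^+ 2) ?rmean_cst//.
apply/funext => e; rewrite (bigD1 i)//= eqxx scale1r big1 ?addr0.
  by rewrite normrZ normrX normrN normr1 expr1n mul1r.
by move=> k /negbTE ->; rewrite scale0r scaler0.
Qed.

Lemma radavg_line (I : finType) (c : I -> R) (y : V) :
  radavg (fun i => c i *: y) = (\sum_i c i ^+ 2) * `|y| ^+ 2.
Proof.
have -> : radavg (fun i => c i *: y) =
    rmean (fun e : {ffun I -> bool} => `|y| ^+ 2 * (\sum_i (-1) ^+ e i * c i) ^+ 2).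
  rewrite /radavg; congr rmean; apply/funext => e.
  under eq_bigr do rewrite scalerA.
  by rewrite -scaler_suml normrZ exprMn real_normK ?num_real// mulrC.
rewrite rmeanZ mulrC; congr (_ * _).
have cross i j : rmean (fun e : {ffun I -> bool} => (-1) ^+ e i * (-1) ^+ e j) =
    (i == j)%:R :> R.
  have [->|ij] := eqVneq i j.
    rewrite -[RHS](rmean_cst I 1); congr rmean; apply/funext => e.
    by rewrite -expr2 sqrr_sign.
  (* Flipping the sign at i negates the product, so its mean is its own negative. *)
  rewrite mulr0n; set r := rmean _; suff : r = - r by move: r => r; lra.
  rewrite /r -[LHS](rmean_flip [ffun k => k == i]) -[RHS]mulN1r -rmeanZ.
  congr rmean; apply/funext => e.
  by rewrite !ffunE eqxx eq_sym (negbTE ij) /= signrN mulN1r mulNr.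
rewrite (_ : (fun e => _) = fun e : {ffun I -> bool} =>
    \sum_i \sum_j (c i * c j) * ((-1) ^+ e i * (-1) ^+ e j)); last first.
  apply/funext => e; rewrite expr2 mulr_suml; apply: eq_bigr => i _.
  by rewrite mulr_sumr; apply: eq_bigr => j _; ring.
rewrite rmean_sum; apply: eq_bigr => i _; rewrite rmean_sum (bigD1 i)//= big1.
  by rewrite rmeanZ cross eqxx mulr1 addr0.
by move=> j ji; rewrite rmeanZ cross eq_sym (negbTE ji) mulr0.
Qed.

(* Bounding the number of nonzero vectors, not their total number M, leaves the
   number of colours below unrestricted. *)
Definition rad_cotype_upto (n : nat) (B : R) : Prop :=
  forall M (x : 'I_M -> V), (#|[pred i | x i != 0%R]| <= n)%N ->
    \sum_i `|x i| ^+ 2 <= B * radavg x.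

Lemma rad_cotype_upto_trivial n : rad_cotype_upto n n%:R.
Proof.
move=> M x supp; rewrite (bigID (fun i => x i != 0))/= [X in _ + X]big1 ?addr0.
  apply: (@le_trans _ _ (\sum_(i | x i != 0) radavg x)).
    by apply: ler_sum => i _; exact: radavg_coord.
  by rewrite sumr_const -[_ *+ _]mulr_natl ler_wpM2r ?radavg_ge0// ler_nat.
by move=> i; rewrite negbK => /eqP ->; rewrite normr0 expr0n.
Qed.

(** For fixed signs e, the cotype bound is applied to the partial sums over the colour classes, with
    new signs d. After exchanging the two means, the coefficient of x_i for fixed d is the sign of
    its colour, or 0 without a colour, and contraction applies. *)
Lemma radavg_colors n B N (x : 'I_N -> V) M (c : {ffun 'I_N -> option 'I_M}) :
  0 <= B -> rad_cotype_upto n B -> (#|[pred i | x i != 0%R]| <= n)%N ->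
  \sum_k radavg (fun i => (c i == Some k)%:R *: x i) <= B * radavg x.
Proof.
move=> B0 cot supp.
rewrite /radavg -rmean_sum.
pose S (e : {ffun 'I_N -> bool}) (k : 'I_M) : V :=
  \sum_i (-1) ^+ e i *: ((c i == Some k)%:R *: x i).
(* A nonzero partial sum needs a nonzero vector of its colour, so at most n of them are nonzero,
   however many colours there are. *)
have suppS e : (#|[pred k | S e k != 0%R]| <= n)%N.
  apply: leq_trans supp; rewrite -(fintype.card_image (@Some_inj _)).
  apply: (@leq_trans #|[seq c i | i in [pred i | x i != 0]]|); last exact: leq_image_card.
  apply: fintype.subset_leq_card.
  apply/fintype.subsetP => _ /fintype.imageP[k + ->]; rewrite inE => Sk.
  apply: contraNT Sk => /negP nim; apply/eqP; apply: big1 => i _.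
  have [xi|xi] := eqVneq (x i) 0; first by rewrite xi !scaler0.
  case: eqP => [ck|]; last by rewrite scale0r scaler0.
  by exfalso; apply: nim; apply/fintype.imageP; exists i.
apply: (@le_trans _ _ (rmean (fun e => B * radavg (S e)))).
  by apply: rmean_le => e; exact: (cot _ _ (suppS e)).
rewrite rmeanZ ler_wpM2l// /radavg rmean_exchange.
rewrite -[leRHS](rmean_cst 'I_M); apply: rmean_le => d.
pose t i : R := if c i is Some k then (-1) ^+ d k else 0.
apply: (@le_trans _ _ (radavg (fun i => t i *: x i))); last first.
  apply: radavg_contract => i; rewrite /t; case: (c i) => [k|]; rewrite ?normr0//.
  by rewrite normrX normrN normr1 expr1n.
apply: rmean_le => e; rewrite le_eqVlt; apply/orP; left; apply/eqP.
congr (`|_| ^+ 2); under eq_bigr do rewrite scaler_sumr.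
rewrite exchange_big/=; apply: eq_bigr => i _.
rewrite /t; case: (c i) => [k|]; last first.
  rewrite big1; first by rewrite scale0r scaler0.
  by move=> k _; rewrite /= scale0r !scaler0.
rewrite (bigD1 k)//= eqxx scale1r big1 ?addr0 => [|l lk].
  by rewrite !scalerA mulrC.
by rewrite (_ : (Some k == Some l) = false) ?scale0r ?scaler0// eq_sym; apply/negbTE.
Qed.

Definition selector_weight I (p : R) : I -> bool -> R :=
  fun _ b => if b then p else 1 - p.

(* Colour each index at random so that each of M colours has probability p; the
   cotype inequality then applies to the M disjoint partial sums. *)
Lemma radavg_selectors n B N (x : 'I_N -> V) (p : R) :
  0 <= B -> rad_cotype_upto n B -> (#|[pred i | x i != 0%R]| <= n)%N ->
  0 <= p <= 1 ->
  \sum_b pweight (@selector_weight 'I_N p) b *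
      radavg (fun i => (b i)%:R *: x i) <= 2 * p * (B * radavg x).
Proof.
move=> B0 cot supp /andP[p0 p1]; set Phi := \sum_b _.
have Bx0 : 0 <= B * radavg x by rewrite mulr_ge0// radavg_ge0.
(* [None] takes the remaining probability 1 - M p. Each of the M other colours selects indices with
   density p, so its mean is again Phi. *)
have colors M : M%:R * p <= 1 -> M%:R * Phi <= B * radavg x.
  move=> Mp; pose w (_ : 'I_N) (k : option 'I_M) : R :=
    if k is Some _ then p else 1 - M%:R * p.
  have w0 i k : 0 <= w i k by rewrite /w; case: k => //; rewrite subr_ge0.
  have sumo (F : option 'I_M -> R) : \sum_k F k = F None + \sum_k F (Some k).
    rewrite (bigD1 None)//=; congr (_ + _).
    rewrite (reindex_omap Some id) => [|[k|]//] /=.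
    by apply: eq_bigl => k; rewrite eqxx.
  have w1 i : \sum_k w i k = 1.
    by rewrite sumo /w sumr_const card_ord -[p *+ M]mulr_natl subrK.
  have PhiE k : Phi = \sum_c pweight w c * radavg (fun i => (c i == Some k)%:R *: x i).
    pose F (b : {ffun 'I_N -> bool}) := radavg (fun i => (b i)%:R *: x i).
    transitivity (\sum_c pweight w c * F [ffun i => c i == Some k]).
      apply: etrans (esym (pweight_push w (fun l => l == Some k) F)).
      apply: eq_bigr => b _; congr (_ * _); apply: eq_bigr => i _.
      have wk : \sum_(l | (l == Some k) == true) w i l = p.
        by under eq_bigl do rewrite eqb_id; rewrite big_pred1_eq.
      case: (b i); rewrite /selector_weight ?wk//.
      rewrite -(w1 i) (bigID (fun l => (l == Some k) == true))/= wk [X in X - _ = _]addrC addrK.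
      by apply: eq_bigl => l; rewrite eqb_id eqbF_neg.
    apply: eq_bigr => c _; congr (_ * _); apply: eq_radavg => i.
    by rewrite ffunE.
  rewrite mulr_natl -[X in _ *+ X]card_ord -sumr_const.
  rewrite (eq_bigr _ (fun k _ => PhiE k)) exchange_big/=.
  rewrite -[leRHS]mul1r -[X in _ <= X * _](sum_pweight w1) mulr_suml.
  apply: ler_sum => c _; rewrite -mulr_sumr ler_wpM2l ?pweight_ge0//.
  exact: (radavg_colors c B0 cot supp).
have Phi0 : 0 <= Phi.
  apply: sumr_ge0 => b _; rewrite mulr_ge0 ?radavg_ge0// pweight_ge0//.
  by move=> i []; rewrite /selector_weight ?subr_ge0.
(* For p = 0 every M is admissible in [colors], which forces Phi = 0. *)
have [p00|pn0] := eqVneq p 0.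
  rewrite p00 mulr0 mul0r leNgt; apply/negP => Phigt.
  have := archi_boundP (divr_ge0 Bx0 Phi0); rewrite ltr_pdivrMr// => /lt_geF.
  by rewrite colors// p00 mulr0.
have pgt : 0 < p by rewrite lt_def pn0.
(* As p <= 1, the integer part of 1/p satisfies M p >= 1/2, whence the factor 2. *)
pose M := Num.truncn p^-1.
have /andP[M1 M2] : M%:R <= p^-1 < M.+1%:R.
  by apply: truncn_itv; rewrite invr_ge0.
have Mp : M%:R * p <= 1 by rewrite -ler_pdivlMr// mul1r.
have M2p : 1 <= 2 * p * M%:R.
  have Mgt : 1 <= M%:R :> R.
    rewrite ler1n lt0n; apply/negP => /eqP M00; move: M2; rewrite M00.
    by rewrite invf_lt1// ltNge p1.
  have : 1 <= M.+1%:R * p by rewrite -ler_pdivrMr// mul1r ltW.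
  rewrite -natr1.
  have : 1 * p <= M%:R * p by rewrite ler_wpM2r.
  by lra.
apply: (@le_trans _ _ (2 * p * M%:R * Phi)); first by rewrite ler_peMl.
by rewrite -mulrA ler_wpM2l ?mulr_ge0// colors.
Qed.

(** Peel off the layer M < |t_i| <= 2 M, bound its coefficients by 2 M, and repeat with 2 M for M.
    Each split costs a factor 2 by [radavgD], and monotonicity enlarges each layer to all indices
    above its lower level. *)
Lemma radavg_layers N (x : 'I_N -> V) L (M : R) (t : 'I_N -> R) : 0 < M ->
  (forall i, `|t i| <= 2 ^+ L * M) -> (forall i, t i = 0 \/ M < `|t i|) ->
  radavg (fun i => t i *: x i) <=
  \sum_(k < L) 2 ^+ k.+1 * (2 ^+ k.+1 * M) ^+ 2 *
     radavg (fun i => (2 ^+ k * M < `|t i|)%R%:R *: x i).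
Proof.
elim: L M t => [|L IH] M t M0 tL tM.
  rewrite big_ord0 /radavg (_ : (fun e => _) = fun=> 0) ?rmean_cst//.
  apply/funext => e; rewrite big1 ?normr0 ?expr0n// => i _.
  have [->|] := tM i; first by rewrite scale0r scaler0.
  by have := tL i; rewrite expr0 mul1r leNgt => /negbTE ->.
pose t1 i := (`|t i| <= 2 * M)%R%:R * t i.
pose t2 i := (2 * M < `|t i|)%R%:R * t i.
have -> : (fun i => t i *: x i) = (fun i => t1 i *: x i + t2 i *: x i).
  apply/funext => i; rewrite -scalerDl /t1 /t2 -mulrDl -natrD.
  by case: leP; rewrite ?addn0 ?add0n mul1r.
apply: (le_trans (radavgD _ _)); rewrite big_ord_recl /=.
apply: lerD.
  rewrite expr1 -mulrA ler_pM2l// -radavgZ expr0 mul1r.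
  under [leRHS]eq_radavg do rewrite scalerA.
  apply: radavg_monotone => i; rewrite /t1.
  have [->|ti] := tM i; first by rewrite mulr0 normr0.
  rewrite ti mulr1; case: (leP `|t i| (2 * M)) => ht; last by rewrite mul0r normr0.
  by rewrite mul1r [leRHS]ger0_norm// mulr_ge0// ltW.
apply: (@le_trans _ _ (2 * \sum_(k < L) 2 ^+ k.+1 * (2 ^+ k.+1 * (2 * M)) ^+ 2 *
     radavg (fun i => (2 ^+ k * (2 * M) < `|t2 i|)%R%:R *: x i))).
  rewrite ler_pM2l//; apply: IH.
  - by rewrite mulr_gt0.
  - move=> i; rewrite /t2 mulrA -exprSr; case: ltP => _; rewrite ?mul1r//.
    by rewrite mul0r normr0 mulr_ge0 ?exprn_ge0// ltW.
  - by move=> i; rewrite /t2; case: ltP; rewrite ?mul1r ?mul0r; [right|left].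
rewrite mulr_sumr; apply: ler_sum => k _.
rewrite /bump /= add1n.
have -> : 2 ^+ k * (2 * M) = 2 ^+ k.+1 * M by rewrite exprS; ring.
set a := radavg _.
have -> : 2 * (2 ^+ k.+1 * (2 ^+ k.+1 * (2 * M)) ^+ 2 * a) =
    2 ^+ k.+2 * (2 ^+ k.+2 * M) ^+ 2 * a by rewrite !exprS; ring.
apply: ler_wpM2l; first by rewrite mulr_ge0 ?sqr_ge0 ?exprn_ge0.
apply: radavg_monotone => i; rewrite /t2.
case: (ltP (2 * M)) => h; first by rewrite mul1r.
rewrite mul0r normr0 ltNge mulr_ge0 ?exprn_ge0 ?(ltW M0)//= normr0.
exact: normr_ge0.
Qed.

End Rademacher.

(** * Laws of random sums *)

Import HBNNSimple.

Section SimpleApproximation.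
Context (R : realType).

(** Approximations a of the positive part give q(t) = a(t) - a(-t). The same q is applied to every
    coordinate, and |q(t)| <= |t| provides domination. *)
Lemma simple_approx_id : exists q : nat -> R -> R,
  [/\ forall k, measurable_fun setT (q k), forall k, finite_set (range (q k)),
      forall k t, `|q k t| <= `|t| & forall t, q ^~ t @ \oo --> t].
Proof.
pose pos (t : R) : \bar R := (Num.max t 0)%:E.
have pos0 t : setT t -> (0 <= pos t)%E by rewrite lee_fin le_max lexx orbT.
have mpos : measurable_fun setT pos.
  by apply/measurable_EFinP; exact: (@measurable_maxr _ _ _ setT (fun t : R => t) (fun=> 0)).
pose a := nnsfun_approx measurableT mpos.
have ale k t : a k t <= Num.max t 0.
  by rewrite /a nnsfun_approxE -lee_fin; exact: le_approx.
have acvg t : a ^~ t @ \oo --> Num.max t 0.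
  rewrite /a; under eq_fun do rewrite nnsfun_approxE.
  exact: (@cvg_approx _ _ _ setT pos t pos0 Logic.I (ltry _)).
exists (fun k t => a k t - a k (- t)); split=> [k|k|k t|t].
- by apply: measurable_funB => //; apply: measurableT_comp.
- apply: (@sub_finite_set _ _ [set u - v | u in range (a k) & v in range (a k)]).
    by move=> _ [t _ <-]; exists (a k t); [exists t|exists (a k (- t))=> //; exists (- t)].
  by apply: finite_image2; exact: fimfunP.
- have h1 := ale k t; have h2 := ale k (- t).
  have h3 : 0 <= a k t by []. have h4 : 0 <= a k (- t) by [].
  rewrite ler_norml; move: h1 h2.
  by case: (leP t 0); case: (leP (- t) 0); case: (ger0P t) => *; apply/andP; split; lra.
- rewrite [X in _ --> X](_ : t = Num.max t 0 - Num.max (- t) 0); last first.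
    by case: (leP t 0); case: (leP (- t) 0); lra.
  by apply: cvgB; exact: acvg.
Qed.

End SimpleApproximation.

Section FiniteExpectation.
Context d (T : measurableType d) (R : realType) (P : probability T R).
Context (J : finType) (k : T -> J).
Hypothesis mk : forall v, measurable (k @^-1` [set v]).

Let kE (F : J -> R) w : F (k w) = \sum_v F v * \1_(k @^-1` [set v]) w.
Proof.
rewrite (bigD1 (k w))//= big1 => [|v vk].
  by rewrite addr0 indicE mem_set ?mulr1.
by rewrite indicE memNset ?mulr0//= => kv; move: vk; rewrite kv eqxx.
Qed.

Lemma measurable_finite_comp (F : J -> R) : measurable_fun setT (fun w => F (k w)).
Proof.
under eq_fun do rewrite kE.
by apply: measurable_sum => v; apply: measurable_funM => //; exact: measurable_indic.
Qed.

Lemma integral_finite_comp (F : J -> R) : (forall v, 0 <= F v) ->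
  (\int[P]_w (F (k w))%:E = \sum_v (F v)%:E * P (k @^-1` [set v]))%E.
Proof.
move=> F0; under eq_integral do rewrite kE -sumEFin.
rewrite ge0_integral_sum//.
- apply: eq_bigr => v _; under eq_integral do rewrite EFinM.
  rewrite ge0_integralZl_EFin//; last by apply/measurable_EFinP; exact: measurable_indic.
  by rewrite integral_indic// setIT.
- move=> v; apply/measurable_EFinP; apply: measurable_funM => //; exact: measurable_indic.
- by move=> v w _; rewrite lee_fin mulr_ge0.
Qed.

End FiniteExpectation.

(** * Mean squares depend only on the law of the coefficients *)

Section JointLaw.
Context d (T : measurableType d) (R : realType) (P : probability T R).
Context (V : normedModType R) (n : nat) (y : 'I_n -> V).
Implicit Types f g : 'I_n -> T -> R.

Definition sqnorm_comb (t : 'I_n -> R) : R := `|\sum_j t j *: y j| ^+ 2.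

(** A form of the Cauchy-Schwarz inequality; it gives the integrable majorant for dominated
    convergence. *)
Lemma sqnorm_comb_le t : sqnorm_comb t <= \sum_j (n%:R * `|y j| ^+ 2) * t j ^+ 2.
Proof.
pose a j := `|t j| * `|y j|.
apply: (@le_trans _ _ ((\sum_j a j) ^+ 2)).
  rewrite lerXn2r ?nnegrE ?sumr_ge0//; first by move=> j _; rewrite mulr_ge0.
  by apply: (le_trans (ler_norm_sum _ _ _)); apply: ler_sum => j _; rewrite normrZ.
apply: (@le_trans _ _ (\sum_i \sum_j (a i ^+ 2 / 2 + a j ^+ 2 / 2))).
  rewrite expr2 mulr_suml; apply: ler_sum => i _; rewrite mulr_sumr.
  apply: ler_sum => j _; have := sqr_ge0 (a i - a j); rewrite !expr2; lra.
under eq_bigr do rewrite big_split/= sumr_const card_ord.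
rewrite big_split/= sumr_const card_ord sumrMnl -mulr_suml -mulrnDl -splitr.
rewrite -[leLHS]mulr_natl mulr_sumr; apply: ler_sum => j _.
by rewrite /a exprMn real_normK ?num_real// mulrA mulrAC.
Qed.

Lemma sqnorm_comb_cvg (s : nat -> 'I_n -> R) t :
  (forall j, s k j @[k --> \oo] --> t j) ->
  sqnorm_comb (s k) @[k --> \oo] --> sqnorm_comb t.
Proof.
move=> st; rewrite /sqnorm_comb.
under eq_fun do rewrite expr2; rewrite expr2.
have h : `|\sum_j s k j *: y j| @[k --> \oo] --> `|\sum_j t j *: y j|.
  apply: cvg_norm; apply: cvg_big => [|j _]; first exact: add_continuous.
  by apply: cvgZr_tmp.
exact: (cvgM h h).
Qed.

Section Approximant.
Variables (q : R -> R) (mq : measurable_fun setT q) (fq : finite_set (range q)).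

Let s : seq R := fset_set (range q).
(** The successor is the form that [inord] requires; the last index is never a value of h. *)
Let h (t : R) : 'I_(size s).+1 := inord (index (q t) s).

Let q_s t : q t \in s.
Proof. by rewrite in_fset_set// inE; exists t. Qed.

Let index_lt t : (index (q t) s < size s)%N.
Proof. by rewrite index_mem. Qed.

Let val_h t : h t = index (q t) s :> nat.
Proof. by rewrite /h inordK// ltnS ltnW. Qed.

Let nth_h t : nth 0 s (h t) = q t.
Proof. by rewrite val_h nth_index. Qed.

Let measurable_h i : measurable (h @^-1` [set i]).
Proof.
have [is_|is_] := ltnP i (size s); last first.
  rewrite (_ : _ @^-1` _ = set0)// -subset0 => t /= hti.
  by have := index_lt t; rewrite -val_h hti ltnNge is_.
rewrite (_ : _ @^-1` _ = q @^-1` [set nth 0 s i]).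
  by rewrite -[X in measurable X]setTI; exact: mq.
apply/seteqP; split=> t /= => [<-|qt]; first by rewrite nth_h.
by apply: val_inj; rewrite /= val_h qt index_uniq ?fset_uniq.
Qed.

Let code f (w : T) : {ffun 'I_n -> 'I_(size s).+1} := [ffun j => h (f j w)].

Let codeE f v : code f @^-1` [set v] =
  \bigcap_(j in setT) (f j @^-1` (h @^-1` [set v j])).
Proof.
apply/seteqP; split=> w /= => [<- j _|H]; first by rewrite /= ffunE.
by apply/ffunP => j; rewrite ffunE; exact: H.
Qed.

Let measurable_code f v : (forall j, measurable_fun setT (f j)) ->
  measurable (code f @^-1` [set v]).
Proof.
move=> mf; rewrite codeE; apply: fin_bigcap_measurable => // j _.
by rewrite -[X in measurable X]setTI; exact: mf.
Qed.

Let decode (v : {ffun 'I_n -> 'I_(size s).+1}) : R :=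
  sqnorm_comb (fun j => nth 0 s (v j)).

Let decodeE f w : sqnorm_comb (fun j => q (f j w)) = decode (code f w).
Proof. by congr sqnorm_comb; apply/funext => j; rewrite ffunE nth_h. Qed.

Lemma measurable_sqnorm_comb_simple f : (forall j, measurable_fun setT (f j)) ->
  measurable_fun setT (fun w => sqnorm_comb (fun j => q (f j w))).
Proof.
move=> mf; under eq_fun do rewrite decodeE.
by apply: measurable_finite_comp => v; exact: measurable_code.
Qed.

(** Equal probabilities of rectangles suffice, because the level sets of the finitely valued [code]
    are rectangles. *)
Lemma integral_sqnorm_comb_simple f g :
  (forall j, measurable_fun setT (f j)) -> (forall j, measurable_fun setT (g j)) ->
  (forall B : 'I_n -> set R, (forall j, measurable (B j)) ->
    P (\bigcap_(j in setT) (f j @^-1` B j)) = P (\bigcap_(j in setT) (g j @^-1` B j))) ->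
  (\int[P]_w (sqnorm_comb (fun j => q (f j w)))%:E =
   \int[P]_w (sqnorm_comb (fun j => q (g j w)))%:E)%E.
Proof.
move=> mf mg law.
under eq_integral do rewrite decodeE.
under [RHS]eq_integral do rewrite decodeE.
rewrite !integral_finite_comp//; try by move=> v; exact: measurable_code.
2-3: by move=> v; exact: sqr_ge0.
apply: eq_bigr => v _; congr (_ * _)%E.
by rewrite !codeE; apply: law => j; exact: measurable_h.
Qed.

End Approximant.

Lemma measurable_sqnorm_comb f : (forall j, measurable_fun setT (f j)) ->
  measurable_fun setT (fun w => sqnorm_comb (f ^~ w)).
Proof.
move=> mf; have [q [mq fq _ qcvg]] := simple_approx_id R.
apply: (@measurable_fun_cvg _ _ _ setT (fun k w => sqnorm_comb (fun j => q k (f j w)))).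
  by move=> k; exact: measurable_sqnorm_comb_simple.
by move=> w _; apply: sqnorm_comb_cvg => j; exact: qcvg.
Qed.

Lemma integral_sum_sqr (c : 'I_n -> R) f : (forall j, 0 <= c j) ->
  (forall j, measurable_fun setT (f j)) ->
  (\int[P]_w (\sum_j c j * f j w ^+ 2)%:E =
   \sum_j (c j)%:E * \int[P]_w (f j w ^+ 2)%:E)%E.
Proof.
move=> c0 mf; under eq_integral do rewrite -sumEFin.
rewrite ge0_integral_sum//.
- apply: eq_bigr => j _; under eq_integral do rewrite EFinM.
  rewrite ge0_integralZl_EFin//.
  + by move=> w _; rewrite lee_fin; exact: sqr_ge0.
  + by apply/measurable_EFinP; exact: measurable_funX.
- move=> j; apply/measurable_EFinP; apply: measurable_funM => //.
  exact: measurable_funX.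
- by move=> j w _; rewrite lee_fin mulr_ge0// sqr_ge0.
Qed.

Lemma measurable_sum_sqr (c : 'I_n -> R) f : (forall j, measurable_fun setT (f j)) ->
  measurable_fun setT (fun w => \sum_j c j * f j w ^+ 2).
Proof.
move=> mf; apply: measurable_sum => j; apply: measurable_funM => //.
exact: measurable_funX.
Qed.

Lemma integral_sum_sqr_lty (c : 'I_n -> R) f : (forall j, 0 <= c j) ->
  (forall j, measurable_fun setT (f j)) ->
  (forall j, (\int[P]_w (f j w ^+ 2)%:E < +oo)%E) ->
  (\int[P]_w (\sum_j c j * f j w ^+ 2)%:E < +oo)%E.
Proof.
move=> c0 mf f2; rewrite integral_sum_sqr//; apply: lte_sum_pinfty => j _.
by apply: lte_mul_pinfty => //; rewrite lee_fin.
Qed.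

Let c0 j : 0 <= n%:R * `|y j| ^+ 2.
Proof. by rewrite mulr_ge0// sqr_ge0. Qed.

Lemma integral_sqnorm_comb_fin f : (forall j, measurable_fun setT (f j)) ->
  (forall j, (\int[P]_w (f j w ^+ 2)%:E < +oo)%E) ->
  (\int[P]_w (sqnorm_comb (f ^~ w))%:E)%E \is a fin_num.
Proof.
move=> mf f2; rewrite ge0_fin_numE; last first.
  by apply: integral_ge0 => w _; rewrite lee_fin sqr_ge0.
apply: le_lt_trans (integral_sum_sqr_lty c0 mf f2).
apply: ge0_le_integral => //.
- by move=> w _; rewrite lee_fin sqr_ge0.
- by apply/measurable_EFinP; exact: measurable_sqnorm_comb.
- by apply/measurable_EFinP; exact: measurable_sum_sqr.
- by move=> w _; rewrite lee_fin; exact: sqnorm_comb_le.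
Qed.

Lemma integral_sqnorm_comb_law f g :
  (forall j, measurable_fun setT (f j)) -> (forall j, measurable_fun setT (g j)) ->
  (forall j, (\int[P]_w (f j w ^+ 2)%:E < +oo)%E) ->
  (forall j, (\int[P]_w (g j w ^+ 2)%:E < +oo)%E) ->
  (forall B : 'I_n -> set R, (forall j, measurable (B j)) ->
    P (\bigcap_(j in setT) (f j @^-1` B j)) = P (\bigcap_(j in setT) (g j @^-1` B j))) ->
  (\int[P]_w (sqnorm_comb (f ^~ w))%:E = \int[P]_w (sqnorm_comb (g ^~ w))%:E)%E.
Proof.
move=> mf mg f2 g2 law; have [q [mq fq qle qcvg]] := simple_approx_id R.
have key f' : (forall j, measurable_fun setT (f' j)) ->
    (forall j, (\int[P]_w (f' j w ^+ 2)%:E < +oo)%E) ->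
    (\int[P]_w (sqnorm_comb (fun j => q k (f' j w)))%:E @[k --> \oo] -->
     \int[P]_w (sqnorm_comb (f' ^~ w))%:E)%E.
  move=> mf' f2'.
  pose G w := (\sum_j (n%:R * `|y j| ^+ 2) * f' j w ^+ 2).
  have mG : measurable_fun setT G by exact: measurable_sum_sqr.
  have G0 w : 0 <= G w by rewrite sumr_ge0// => j _; rewrite mulr_ge0 ?c0 ?sqr_ge0.
  apply: (@dominated_cvg _ _ _ P setT measurableT _ _ (EFin \o G)).
  - move=> k; apply/measurable_EFinP; exact: measurable_sqnorm_comb_simple.
  - move=> w _; apply: cvg_EFin; first exact: nearW.
    by apply: (@sqnorm_comb_cvg (fun k j => q k (f' j w))) => j; exact: qcvg.
  - by move=> w _.
  - apply/integrableP; split; first exact/measurable_EFinP.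
    under eq_integral do rewrite gee0_abs ?lee_fin//.
    exact: integral_sum_sqr_lty.
  - move=> k w _; rewrite gee0_abs ?lee_fin ?sqr_ge0//.
    apply: (le_trans (sqnorm_comb_le _)); apply: ler_sum => j _.
    apply: ler_wpM2l; first by rewrite mulr_ge0// sqr_ge0.
    by rewrite -real_normK ?num_real// -[leRHS]real_normK ?num_real// lerXn2r ?nnegrE.
have kf := key f mf f2; have kg := key g mg g2.
have E : (fun k => \int[P]_w (sqnorm_comb (fun j => q k (f j w)))%:E)%E =
    (fun k => \int[P]_w (sqnorm_comb (fun j => q k (g j w)))%:E)%E.
  by apply/funext => k; exact: integral_sqnorm_comb_simple.
by rewrite E in kf; exact: (cvg_unique _ kf kg).
Qed.

End JointLaw.

Section Independent.
Context d (T : measurableType d) (R : realType) (P : probability T R).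
Variable xi : nat -> {RV P >-> R}.

Lemma independent_rect n (B : 'I_n -> set R) : independent_rvs xi ->
  (forall j, measurable (B j)) ->
  P (\bigcap_(j in [set: 'I_n]) (xi j @^-1` B j)) = (\prod_(j < n) P (xi j @^-1` B j))%E.
Proof.
move=> indep mB.
pose B' (i : nat) := if insub i is Some j then B j else setT.
have B'E (j : 'I_n) : B' j = B j by rewrite /B' valK.
have := indep [fset i in iota 0 n]%fset B'.
have mB' i : measurable (B' i) by rewrite /B'; case: insub.
move=> /(_ mB').
rewrite (_ : \bigcap_(i in _) _ = \bigcap_(j in [set: 'I_n]) (xi j @^-1` B j)); last first.
  apply/seteqP; split=> w /= H.
    by move=> j _ /=; rewrite -B'E; apply: H; rewrite /= !inE mem_iota /=.
  move=> i /=; rewrite !inE mem_iota /= add0n => ilt.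
  by rewrite -[i]/(val (Ordinal ilt)) B'E; exact: H.
move=> ->.
rewrite (perm_big (index_iota 0 n)) ?big_mkord /=.
  by apply: eq_bigr => j _; rewrite B'E.
apply: uniq_perm; rewrite ?fset_uniq ?iota_uniq// => i.
by rewrite !inE /index_iota subn0.
Qed.

Hypothesis xi_iid : iid xi.

(** The link from P to finite product measures: the events [a (xi j)] are independent with a common
    probability. *)
Lemma integral_selectors n (F : {ffun 'I_n -> bool} -> R) (a : R -> bool) :
  measurable [set t | a t] -> (forall b, 0 <= F b) ->
  (\int[P]_w (F [ffun j : 'I_n => a (xi j w)])%:E =
   (\sum_b pweight (selector_weight (fine (P (xi 0%N @^-1` [set t | a t])))) b * F b)%:E)%E.
Proof.
move=> ma F0; set p := fine _.
have pE j : P (xi j @^-1` [set t | a t]) = p%:E.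
  rewrite /p fineK ?fin_num_measure//; first exact: xi_iid.2.
  by rewrite -[X in measurable X]setTI; exact: measurable_funPT.
have pC j : P (xi j @^-1` [set t | ~~ a t]) = (1 - p)%:E.
  rewrite EFinB -(pE j) -probability_setC.
    by congr (P _); apply/seteqP; split=> w /= /negP.
  by rewrite -[X in measurable X]setTI; exact: measurable_funPT.
pose ab (b : bool) := [set t | a t = b].
have mab b : measurable (ab b).
  case: b => //; rewrite (_ : ab false = ~` [set t | a t]); first exact: measurableC.
  by apply/seteqP; split=> t /=; [move=> ->|move/negP/negbTE].
have kE (b : {ffun 'I_n -> bool}) :
    (fun w => [ffun j : 'I_n => a (xi j w)]) @^-1` [set b] =
    \bigcap_(j in [set: 'I_n]) (xi j @^-1` ab (b j)).
  apply/seteqP; split=> w /= => [<- j _|H]; first by rewrite /= /ab /= ffunE.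
  by apply/ffunP => j; rewrite ffunE; exact: H.
rewrite integral_finite_comp//; last first.
  move=> b; rewrite kE; apply: fin_bigcap_measurable => // j _.
  by rewrite -[X in measurable X]setTI; exact: measurable_funPT.
rewrite -sumEFin; apply: eq_bigr => b _; rewrite kE muleC EFinM; congr (_ * _)%E.
rewrite independent_rect//; last exact: xi_iid.1.
rewrite /pweight -prodEFin; apply: eq_bigr => j _.
rewrite /selector_weight; case: (b j); first exact: pE.
rewrite -(pC j); congr (P _).
by apply/seteqP; split=> w /=; rewrite /ab /=; [move=> ->|move/negbTE].
Qed.

End Independent.

(** * Symmetrization *)

Section Symmetrization.
Context d (T : measurableType d) (R : realType) (P : probability T R).
Variable xi : nat -> {RV P >-> R}.
Hypotheses (xi_iid : iid xi) (xi_sym : forall j, symmetric_rv (xi j)).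
Hypothesis xi_var : forall j, 'E_P[fun w => (`|xi j w| ^+ 2)%R]%E = 1%E.
Context (V : normedModType R).

Definition sqmean n (x : 'I_n -> V) : R :=
  fine 'E_P[fun w => `|\sum_(j < n) xi j w *: x j| ^+ 2].

Let mxi j : measurable_fun setT (xi j).
Proof. exact: measurable_funPT. Qed.

Lemma integral_sqr_rv j : (\int[P]_w (xi j w ^+ 2)%:E = 1)%E.
Proof.
rewrite -(xi_var j) unlock; apply: eq_integral => w _.
by rewrite real_normK ?num_real.
Qed.

Let xi2 j : (\int[P]_w (xi j w ^+ 2)%:E < +oo)%E.
Proof. by rewrite integral_sqr_rv ltry. Qed.

Lemma sqmeanE n (x : 'I_n -> V) :
  (sqmean x)%:E = (\int[P]_w (sqnorm_comb x (fun j => xi j w))%:E)%E.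
Proof.
rewrite /sqmean unlock fineK//.
apply: (@integral_sqnorm_comb_fin _ _ _ P _ _ x (fun j : 'I_n => xi j)) => j.
  exact: mxi.
exact: xi2.
Qed.

Lemma sqmean_ge0 n (x : 'I_n -> V) : 0 <= sqmean x.
Proof.
by rewrite fine_ge0//; apply: expectation_ge0 => w; exact: sqr_ge0.
Qed.

Lemma random_sum_L2E n (x : 'I_n -> V) :
  random_sum_L2 xi x = (Num.sqrt (sqmean x))%:E.
Proof. by rewrite /random_sum_L2 (_ : expectation _ _ = (sqmean x)%:E)// sqmeanE unlock. Qed.

(** Independence factorizes the probability of a rectangle, and symmetry allows the sign of each
    coordinate to be changed separately. *)
Lemma integral_flip n (x : 'I_n -> V) (e : {ffun 'I_n -> bool}) :
  (\int[P]_w (sqnorm_comb x (fun j => (-1) ^+ e j * xi j w))%:E = (sqmean x)%:E)%E.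
Proof.
rewrite sqmeanE.
have mf (j : 'I_n) : measurable_fun setT (fun w => (-1) ^+ e j * xi j w).
  by apply: measurable_funM => //; exact: mxi.
apply: (@integral_sqnorm_comb_law _ _ _ P _ _ x
    (fun (j : 'I_n) w => (-1) ^+ e j * xi j w) (fun j : 'I_n => xi j)) => //.
  by move=> j; under eq_integral do rewrite exprMn sqrr_sign mul1r; exact: xi2.
move=> B mB.
have me (j : 'I_n) : measurable [set t : R | B j ((-1) ^+ e j * t)].
  by rewrite -[X in measurable X]setTI; exact: (@mulrl_measurable R setT ((-1) ^+ e j)).
rewrite [RHS]independent_rect//; last exact: xi_iid.1.
transitivity (P (\bigcap_(j in [set: 'I_n])
  (xi j @^-1` [set t : R | B j ((-1) ^+ e j * t)]))) => //.
rewrite independent_rect//; last exact: xi_iid.1.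
apply: eq_bigr => j _; case: (e j); last first.
  by congr (P _); apply/seteqP; split=> w /=; rewrite expr0 mul1r.
rewrite [RHS]xi_sym//; congr (P _).
by apply/seteqP; split=> w /=; rewrite expr1 mulN1r.
Qed.

Lemma radavg_sqnorm_comb n (x : 'I_n -> V) (t : 'I_n -> R) :
  radavg (fun j => t j *: x j) =
  rmean (fun e : {ffun 'I_n -> bool} => sqnorm_comb x (fun j => (-1) ^+ e j * t j)).
Proof.
congr rmean; apply/funext => e; congr (`|_| ^+ 2).
by apply: eq_bigr => j _; rewrite scalerA.
Qed.

Lemma measurable_radavg n (x : 'I_n -> V) (f : 'I_n -> T -> R) :
  (forall j, measurable_fun setT (f j)) ->
  measurable_fun setT (fun w => radavg (fun j => f j w *: x j)).
Proof.
move=> mf; under eq_fun do rewrite radavg_sqnorm_comb.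
apply: measurable_funM => //; apply: measurable_sum => e.
apply: (@measurable_sqnorm_comb _ _ _ _ _ x (fun j w => (-1) ^+ e j * f j w)) => j.
exact: measurable_funM.
Qed.

(** [integral_flip] averaged over all e. The signs are a finite mean inside the integral, so no
    second probability space is involved. *)
Lemma sqmean_symmetrize n (x : 'I_n -> V) :
  (sqmean x)%:E = (\int[P]_w (radavg (fun j : 'I_n => xi j w *: x j))%:E)%E.
Proof.
under eq_integral do rewrite radavg_sqnorm_comb /rmean EFinM -sumEFin.
have mf (e : {ffun 'I_n -> bool}) : measurable_fun setT
    (fun w => (sqnorm_comb x (fun j => (-1) ^+ e j * xi j w))%:E).
  apply/measurable_EFinP.
  apply: (@measurable_sqnorm_comb _ _ _ _ _ x (fun (j : 'I_n) w => (-1) ^+ e j * xi j w)) => j.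
  by apply: measurable_funM => //; exact: mxi.
rewrite ge0_integralZl_EFin//.
- rewrite ge0_integral_sum//.
    under eq_bigr do rewrite integral_flip.
    by rewrite sumEFin -EFinM -[RHS]/((rmean (fun=> sqmean x))%:E) rmean_cst.
  by move=> e w _; rewrite lee_fin sqr_ge0.
- by move=> w _; rewrite sumEFin lee_fin sumr_ge0// => e _; exact: sqr_ge0.
- exact: emeasurable_sum.
Qed.

Lemma sqmean_le_sum n (x : 'I_n -> V) (B : R) : 0 <= B ->
  (forall z : 'I_n -> V, radavg z <= B * \sum_j `|z j| ^+ 2) ->
  sqmean x <= B * \sum_j `|x j| ^+ 2.
Proof.
move=> B0 H; rewrite -lee_fin sqmean_symmetrize.
have c0 (j : 'I_n) : 0 <= B * `|x j| ^+ 2 by rewrite mulr_ge0// sqr_ge0.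
apply: (@le_trans _ _ (\int[P]_w (\sum_j (B * `|x j| ^+ 2) * xi j w ^+ 2)%:E)%E).
  apply: ge0_le_integral => //.
  - by move=> w _; rewrite lee_fin radavg_ge0.
  - apply/measurable_EFinP; exact: (measurable_radavg x (fun j : 'I_n => mxi j)).
  - by apply/measurable_EFinP; exact: (measurable_sum_sqr _ (fun j : 'I_n => mxi j)).
  - move=> w _; rewrite lee_fin; apply: (le_trans (H _)); rewrite mulr_sumr.
    apply: ler_sum => j _; rewrite normrZ exprMn real_normK ?num_real//.
    by rewrite mulrA mulrAC.
rewrite (integral_sum_sqr P c0 (fun j : 'I_n => mxi j)).
under eq_bigr do rewrite integral_sqr_rv mule1.
by rewrite sumEFin -mulr_sumr.
Qed.

(** After symmetrization, the orthogonality of the xi_j becomes that of the signs. *)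
Lemma sqmean_line n (c : 'I_n -> R) (y : V) :
  sqmean (fun j => c j *: y) = (\sum_j c j ^+ 2) * `|y| ^+ 2.
Proof.
apply: EFin_inj; rewrite sqmean_symmetrize.
have c0 (j : 'I_n) : 0 <= `|y| ^+ 2 * c j ^+ 2 by rewrite mulr_ge0// sqr_ge0.
transitivity (\int[P]_w (\sum_j (`|y| ^+ 2 * c j ^+ 2) * xi j w ^+ 2)%:E)%E.
  apply: eq_integral => w _; congr (_%:E).
  under eq_radavg do rewrite scalerA.
  rewrite radavg_line mulr_suml; apply: eq_bigr => j _.
  by rewrite exprMn; ring.
rewrite (integral_sum_sqr P c0 (fun j : 'I_n => mxi j)).
under eq_bigr do rewrite integral_sqr_rv mule1.
by rewrite sumEFin -mulr_sumr mulrC.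
Qed.

End Symmetrization.

(** * Comparison of random sums with Rademacher sums *)

Section RademacherExpectation.
Context d (T : measurableType d) (R : realType) (P : probability T R).
Variable r : nat -> {RV P >-> R}.
Hypothesis rad : rademacher r.
Context (V : normedModType R).

Let pre1 j c : measurable (r j @^-1` [set c]).
Proof. by rewrite -[X in measurable X]setTI; exact: measurable_funPT. Qed.

Lemma rademacher_ae j : {ae P, forall w, r j w = 1 \/ r j w = -1}.
Proof.
exists (~` (r j @^-1` [set 1] `|` r j @^-1` [set -1])); split.
- by apply: measurableC; apply: measurableU.
- rewrite probability_setC; last exact: measurableU.
  have disj : r j @^-1` [set 1] `&` r j @^-1` [set -1] = set0.
    by rewrite -subset0 => w /= [-> h]; lra.
  rewrite measureU//; have [h1 h2] := rad.2 j.
  transitivity (1 - ((2^-1)%:E + (2^-1)%:E) : \bar R)%E.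
    by congr (_ - (_ + _))%E; [exact: h1|exact: h2].
  transitivity ((1 - (2^-1 + 2^-1)) : R)%:E; first by [].
  by congr (_%:E); lra.
- by move=> w /= H [h|h]; apply: H; [left|right].
Qed.

Lemma expectation_rademacher n (x : 'I_n -> V) :
  expectation P (fun w => `|\sum_(j < n) r j w *: x j| ^+ 2) = (radavg x)%:E.
Proof.
(* [a (r j w)] is true when the sign is +1, whereas the exponent [true] means -1; hence the
   negation, removed at the end by flipping all signs. *)
pose F (b : {ffun 'I_n -> bool}) := `|\sum_j (-1) ^+ (true (+) b j) *: x j| ^+ 2.
pose a (t : R) := t == 1.
have ma : measurable [set t : R | a t].
  rewrite (_ : [set _ | _] = [set 1]); first exact: measurable_set1.
  by apply/seteqP; split=> t /eqP.
rewrite unlock.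
have mr (j : 'I_n) : measurable_fun setT (r j) by exact: measurable_funPT.
transitivity (\int[P]_w (F [ffun j : 'I_n => a (r j w)])%:E)%E.
  apply: ge0_ae_eq_integral => //.
  - apply/measurable_EFinP.
    exact: (@measurable_sqnorm_comb _ _ _ _ _ x (fun j : 'I_n => r j)).
  - apply/measurable_EFinP; apply: measurable_finite_comp => b.
    rewrite (_ : _ @^-1` _ =
        \bigcap_(j in [set: 'I_n]) (r j @^-1` [set t | a t = b j])).
      apply: fin_bigcap_measurable => // j _.
      rewrite -[X in measurable X]setTI; apply: mr => //.
      case: (b j) => //; rewrite (_ : [set _ | _] = ~` [set t | a t]).
        exact: measurableC.
      by apply/seteqP; split=> t /=; [move=> ->|move/negP/negbTE].
    apply/seteqP; split=> w /= => [<- j _|H]; first by rewrite /= ffunE.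
    by apply/ffunP => j; rewrite ffunE; exact: H.
  - by move=> w _; rewrite lee_fin sqr_ge0.
  have : {ae P, forall w, forall j : 'I_n, r j w = 1 \/ r j w = -1}.
    by apply: filter_forall => j; exact: rademacher_ae.
  move=> rae; apply: (filterS _ rae) => w H _; congr (_%:E); congr (`|_| ^+ 2).
  apply: eq_bigr => j _; rewrite ffunE; congr (_ *: _).
  rewrite /a; have [->|->] := H j; first by rewrite eqxx.
  by rewrite (_ : (-1 == 1 :> R) = false)//; apply/eqP; lra.
rewrite (integral_selectors rad.1 ma)//; last by move=> b; exact: sqr_ge0.
congr (_%:E); rewrite (_ : _ @^-1` _ = r 0%N @^-1` [set 1]); last first.
  by apply/seteqP; split=> t /eqP.
have [-> _] := rad.2 0%N => /=.
rewrite /radavg -[RHS](rmean_flip [ffun=> true]) /rmean mulr_sumr.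
apply: eq_bigr => b _; congr (_ * _).
  rewrite /pweight -[in RHS]cardsT -[X in X ^+ _]/(2^-1) -prodr_const big_set.
  apply: eq_big => // j _; rewrite /selector_weight; case: (b j) => //; lra.
rewrite /F; congr (`|_| ^+ 2); apply: eq_bigr => j _.
by rewrite !ffunE.
Qed.

End RademacherExpectation.

Section Comparison.
Context d (T : measurableType d) (R : realType) (P : probability T R).
Variable xi : nat -> {RV P >-> R}.
Hypotheses (xi_iid : iid xi) (xi_sym : forall j, symmetric_rv (xi j)).
Hypothesis xi_var : forall j, 'E_P[fun w => (`|xi j w| ^+ 2)%R]%E = 1%E.
Context (V : normedModType R).

Let mxi j : measurable_fun setT (xi j).
Proof. exact: measurable_funPT. Qed.

Definition tail (u : R) : R := fine (P (xi 0%N @^-1` [set t | (u < `|t|)%R])).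

Let mtail u : measurable [set t : R | (u < `|t|)%R].
Proof.
rewrite -[X in measurable X]setTI (_ : [set t | _] = Num.norm @^-1` `]u, +oo[).
  exact: (@normr_measurable R setT).
by apply/seteqP; split=> t /=; rewrite in_itv/= andbT.
Qed.

Let mpretail u : measurable (xi 0%N @^-1` [set t | (u < `|t|)%R]).
Proof. by rewrite -[X in measurable X]setTI; exact: mxi. Qed.

Let mtail_indic u j : measurable_fun setT (fun w => (u < `|xi j w|)%R%:R : R).
Proof.
rewrite (_ : (fun w => _) = \1_(xi j @^-1` [set t | (u < `|t|)%R])).
  apply: measurable_indic; rewrite -[X in measurable X]setTI.
  by apply: mxi => //; exact: mtail.
by apply/funext => w; rewrite indicE mem_setE.
Qed.

Lemma tail_itv u : 0 <= tail u <= 1.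
Proof.
rewrite /tail fine_ge0//= -lee_fin fineK ?fin_num_measure//.
exact: probability_le1.
Qed.

Lemma tailE u : (tail u)%:E = P (xi 0%N @^-1` [set t | (u < `|t|)%R]).
Proof. by rewrite /tail fineK// fin_num_measure. Qed.

Lemma integral_tail_selectors n (x : 'I_n -> V) u :
  (\int[P]_w (radavg (fun j : 'I_n => (u < `|xi j w|)%R%:R *: x j))%:E =
   (\sum_b pweight (selector_weight (tail u)) b *
      radavg (fun j : 'I_n => (b j)%:R *: x j))%:E)%E.
Proof.
rewrite -(integral_selectors xi_iid (a := fun t => (u < `|t|)%R))//.
  apply: eq_integral => w _; congr (_%:E).
  by apply: eq_radavg => j; rewrite ffunE.
by move=> b; exact: radavg_ge0.
Qed.

(** Otherwise |xi_0| <= 1/2 almost surely, and the second moment would be at most 1/4. *)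
Lemma tail_half_gt0 : 0 < tail (1 / 2).
Proof.
have /andP[t0 _] := tail_itv (1 / 2).
rewrite lt_def t0 andbT; apply/eqP => t00.
have P0 : P (xi 0%N @^-1` [set t | (1 / 2 < `|t|)%R]) = 0%E by rewrite -tailE t00.
have : (\int[P]_w (xi 0%N w ^+ 2)%:E <= \int[P]_w (1 / 4 : R)%:E)%E.
  apply: ae_ge0_le_integral => //.
  - by move=> w _; rewrite lee_fin sqr_ge0.
  - by apply/measurable_EFinP; apply: measurable_funX; exact: mxi.
  exists (xi 0%N @^-1` [set t | (1 / 2 < `|t|)%R]); split=> // w /= H.
  rewrite ltNge; apply/negP => xw; apply: H => _; rewrite lee_fin.
  rewrite -real_normK ?num_real//.
  rewrite (_ : 1 / 4 = (1 / 2) ^+ 2 :> R); last by field.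
  by rewrite lerXn2r ?nnegrE.
rewrite (integral_sqr_rv xi_var) integral_cst// [X in (_ * X)%E]probability_setT mule1 lee_fin.
by lra.
Qed.

(** Monotonicity replaces |xi_j| by half the indicator of |xi_j| > 1/2, which gives 1/4; convexity
    replaces the indicators by their mean p, which gives p^2. *)
Lemma radavg_le_sqmean n (x : 'I_n -> V) :
  tail (1 / 2) ^+ 2 / 4 * radavg x <= sqmean xi x.
Proof.
set p := tail _; have /andP[p0 p1] := tail_itv (1 / 2).
rewrite -lee_fin sqmean_symmetrize//.
have mfh (j : 'I_n) : measurable_fun setT (fun w => (1 / 2 < `|xi j w|)%R%:R : R).
  exact: mtail_indic.
apply: (@le_trans _ _ (\int[P]_w ((1 / 4) *
    radavg (fun j : 'I_n => (1 / 2 < `|xi j w|)%R%:R *: x j))%:E)%E).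
  under eq_integral do rewrite EFinM.
  rewrite ge0_integralZl_EFin//; last 2 first.
  - by move=> w _; rewrite lee_fin radavg_ge0.
  - by apply/measurable_EFinP; exact: (measurable_radavg x mfh).
  rewrite integral_tail_selectors -/p -EFinM lee_fin.
  rewrite (_ : p ^+ 2 / 4 = 1 / 4 * p ^+ 2); last by field.
  rewrite -(mulrA (1 / 4)); apply: ler_wpM2l; first by lra.
  have w1 (i : 'I_n) : \sum_b selector_weight p i b = 1.
    by rewrite big_bool /selector_weight /= addrC subrK.
  have w0 (i : 'I_n) b : 0 <= selector_weight p i b.
    by case: b; rewrite /selector_weight ?subr_ge0.
  have := @radavg_convex _ V 'I_n _ (pweight (selector_weight p))
    (fun b j => (b j)%:R *: x j) (fun b => pweight_ge0 b w0) (sum_pweight w1).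
  apply: le_trans; rewrite -radavgZ le_eqVlt; apply/orP; left; apply/eqP.
  apply: eq_radavg => j; under eq_bigr do rewrite scalerA.
  rewrite -scaler_suml (pweight_marginal w1 (fun b : bool => b%:R)).
  by rewrite big_bool /selector_weight /= mulr1 mulr0 addr0.
apply: ge0_le_integral => //.
- by move=> w _; rewrite lee_fin mulr_ge0// radavg_ge0.
- apply/measurable_EFinP; apply: measurable_funM => //; exact: (measurable_radavg x mfh).
- by apply/measurable_EFinP; exact: (measurable_radavg x (fun j : 'I_n => mxi j)).
- move=> w _; rewrite lee_fin.
  rewrite (_ : 1 / 4 = (1 / 2) ^+ 2); last by field.
  rewrite -radavgZ; under eq_radavg do rewrite scalerA.
  apply: radavg_monotone => j.
  by case: ltP => h; rewrite ?mulr1 ?mulr0 ?normr0// ger0_norm// ltW.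
Qed.

Hypothesis xi_moments : forall j, finite_moments (xi j).

Definition fourth_moment : R := fine 'E_P[fun w => `|xi 0%N w| ^+ 4].

Lemma fourth_moment_ge0 : 0 <= fourth_moment.
Proof. by rewrite fine_ge0//; apply: expectation_ge0 => w; exact: exprn_ge0. Qed.

Lemma tail_markov u : 0 < u -> tail u <= fourth_moment / u ^+ 4.
Proof.
move=> u0; rewrite ler_pdivlMr ?exprn_gt0// mulrC -lee_fin EFinM tailE.
have -> : fourth_moment%:E = expectation P (fun w => `|xi 0%N w| ^+ 4).
  rewrite /fourth_moment fineK// ge0_fin_numE; first exact: xi_moments.
  by apply: expectation_ge0 => w; exact: exprn_ge0.
have := @markov _ _ _ P (xi 0%N) (fun t => t ^+ 4) u u0.
move=> /(_ (@exprn_measurable R setT 4) (fun r r0 => exprn_ge0 4 r0)) H.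
apply: (le_trans _ (H _)); last by move=> a b a0 b0 ab; exact: lerXn2r.
rewrite lee_wpmul2l ?lee_fin ?exprn_ge0 ?(ltW u0)//.
apply: le_measure; rewrite ?inE//.
  rewrite (_ : [set x | _] = (fun w => `|xi 0%N w|) @^-1` `[u, +oo[); last first.
    by apply/seteqP; split=> w /=; rewrite in_itv/= andbT lee_fin.
  rewrite -[X in measurable X]setTI.
  have mn : measurable_fun setT (fun w => `|xi 0%N w|).
    by apply: measurableT_comp => //; exact: mxi.
  exact: mn.
by move=> w /= ?; rewrite lee_fin ltW.
Qed.

(** L depends on t, hence on the sample point when t is the random sequence; the constants do not,
    so the sum can be completed to a series before integration. *)
Lemma radavg_truncate n (x : 'I_n -> V) (t : 'I_n -> R) (M : R) : 0 < M ->
  exists L, radavg (fun j => t j *: x j) <= 2 * M ^+ 2 * radavg x +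
    \sum_(0 <= k < L) 2 * (2 ^+ k.+1 * (2 ^+ k.+1 * M) ^+ 2) *
       radavg (fun j => (2 ^+ k * M < `|t j|)%R%:R *: x j).
Proof.
move=> M0.
have [L tL] : exists L, forall j, `|t j| <= 2 ^+ L * M.
  pose s := \sum_j `|t j|; exists (Num.bound (s / M)) => j.
  rewrite -ler_pdivrMr//; apply: (@le_trans _ _ (s / M)).
    rewrite ler_pM2r ?invr_gt0// /s (bigD1 j)//= lerDl sumr_ge0//.
  have sM : 0 <= s / M by rewrite divr_ge0 ?sumr_ge0// ltW.
  apply/ltW/(lt_le_trans (archi_boundP sM)).
  by rewrite -natrX ler_nat ltnW// ltn_expl.
exists L.
pose t1 j := (`|t j| <= M)%R%:R * t j.
pose t2 j := (M < `|t j|)%R%:R * t j.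
have t12 : (fun j => t j *: x j) = (fun j => t1 j *: x j + t2 j *: x j).
  apply/funext => j; rewrite -scalerDl /t1 /t2 -mulrDl -natrD.
  by case: (leP `|t j| M); rewrite ?addn0 ?add0n mul1r.
rewrite t12; apply: (le_trans (radavgD _ _)); apply: lerD.
  rewrite -mulrA ler_pM2l// -radavgZ; apply: radavg_monotone => j.
  rewrite /t1; case: (leP `|t j| M) => h; rewrite ?mul1r ?mul0r ?normr0//.
  by rewrite [leRHS]gtr0_norm.
have := @radavg_layers _ V n x L M t2 M0.
have t2L j : `|t2 j| <= 2 ^+ L * M.
  by rewrite /t2; case: ltP => _; rewrite ?mul1r// mul0r normr0 mulr_ge0 ?exprn_ge0// ltW.
have t2M j : t2 j = 0 \/ M < `|t2 j|.
  by rewrite /t2; case: ltP; rewrite ?mul1r ?mul0r; [right|left].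
move=> /(_ t2L t2M) H.
apply: (@le_trans _ _ (2 * \sum_(k < L) 2 ^+ k.+1 * (2 ^+ k.+1 * M) ^+ 2 *
   radavg (fun i => (2 ^+ k * M < `|t2 i|)%R%:R *: x i))); first by rewrite ler_pM2l.
rewrite mulr_sumr big_mkord; apply: ler_sum => k _.
rewrite mulrA; apply: ler_wpM2l.
  by rewrite mulr_ge0// mulr_ge0 ?exprn_ge0// mulr_ge0 ?exprn_ge0// ltW.
apply: radavg_monotone => j; rewrite /t2.
case: (ltP M) => h; first by rewrite mul1r.
by rewrite mul0r normr0 ltNge mulr_ge0 ?exprn_ge0 ?(ltW M0)//= normr0.
Qed.

(** The k-th term has coefficient 16 8^k M^2 and tail at most m / (2^k M)^4; with the factor 2 B of
    [radavg_selectors] this is 32 m B 2^-k / M^2, and summing over k doubles 32 to 64. *)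
Lemma sqmean_le_radavg N (B M : R) n (x : 'I_n -> V) :
  0 <= B -> 0 < M -> rad_cotype_upto V N B ->
  (#|[pred i | x i != 0%R]| <= N)%N ->
  sqmean xi x <= (2 * M ^+ 2 + 64 * fourth_moment * B / M ^+ 2) * radavg x.
Proof.
move=> B0 M0 cot supp; set m := fourth_moment; set A := radavg x.
have m0 : 0 <= m := fourth_moment_ge0.
have A0 : 0 <= A := radavg_ge0 x.
pose c k : R := 2 * (2 ^+ k.+1 * (2 ^+ k.+1 * M) ^+ 2).
have c0 k : 0 <= c k by rewrite mulr_ge0// mulr_ge0 ?exprn_ge0// mulr_ge0 ?exprn_ge0// ltW.
pose u k : R := 2 ^+ k * M.
pose f k w : \bar R := (c k * radavg (fun j : 'I_n => (u k < `|xi j w|)%R%:R *: x j))%:E.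
have mf k : measurable_fun setT (f k).
  apply/measurable_EFinP; apply: measurable_funM => //.
  by apply: (measurable_radavg x) => j; exact: mtail_indic.
have f0 k w : (0 <= f k w)%E by rewrite lee_fin mulr_ge0// radavg_ge0.
pose D : R := 32 * m * B * A / M ^+ 2.
have fD k : (\int[P]_w f k w <= (D * 2^-1 ^+ k)%:E)%E.
  rewrite /f; under eq_integral do rewrite EFinM.
  rewrite ge0_integralZl_EFin//; last 2 first.
  - by move=> w _; rewrite lee_fin radavg_ge0.
  - apply/measurable_EFinP; apply: (measurable_radavg x) => j; exact: mtail_indic.
  rewrite integral_tail_selectors -EFinM lee_fin.
  have uk : 0 < u k by rewrite mulr_gt0// exprn_gt0.
  apply: (@le_trans _ _ (c k * (2 * (m / u k ^+ 4) * (B * A)))).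
    apply: ler_wpM2l => //.
    apply: (le_trans (radavg_selectors B0 cot supp (tail_itv _))).
    apply: ler_wpM2r; first exact: mulr_ge0.
    by apply: ler_wpM2l => //; exact: tail_markov.
  rewrite /c /u /D le_eqVlt; apply/orP; left; apply/eqP.
  have -> : 2^-1 ^+ k = (2 ^+ k)^-1 :> R by rewrite exprVn.
  rewrite exprS; have : 2 ^+ k != 0 :> R by rewrite expf_neq0.
  by move: (2 ^+ k) => a a0; field; rewrite a0 gt_eqF.
have D0 : 0 <= D.
  apply: divr_ge0; last exact: sqr_ge0.
  by apply: mulr_ge0 => //; apply: mulr_ge0 => //; exact: mulr_ge0.
rewrite -lee_fin sqmean_symmetrize//.
apply: (@le_trans _ _ (\int[P]_w ((2 * M ^+ 2 * A)%:E + \sum_(0 <= k <oo) f k w)%E)%E).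
  apply: ge0_le_integral => //.
  - by move=> w _; rewrite lee_fin radavg_ge0.
  - by apply/measurable_EFinP; exact: (measurable_radavg x (fun j : 'I_n => mxi j)).
  - apply: emeasurable_funD => //.
    exact: ge0_emeasurable_sum.
  - move=> w _.
    have [L HL] := radavg_truncate x (fun j : 'I_n => xi j w) M0.
    apply: (@le_trans _ _ ((2 * M ^+ 2 * A)%:E + \sum_(0 <= k < L) f k w)%E).
      by rewrite sumEFin -EFinD lee_fin.
    by apply: leeD2l; apply: nneseries_lim_ge.
rewrite ge0_integralD//; last 3 first.
- by move=> w _; rewrite lee_fin; apply: mulr_ge0 => //; rewrite mulr_ge0// sqr_ge0.
- by move=> w _; exact: nneseries_ge0.
- exact: ge0_emeasurable_sum.
rewrite integral_cst// [X in (_ * X + _)%E]probability_setT mule1 integral_nneseries//.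
have S : (\sum_(0 <= k <oo) \int[P]_w f k w <= (2 * D)%:E)%E.
  apply: lime_le.
    by apply: is_cvg_nneseries => k _ _; apply: integral_ge0 => w _.
  apply: nearW => K.
  apply: (@le_trans _ _ (\sum_(0 <= k < K) (D * 2^-1 ^+ k)%:E)%E).
    by apply: lee_sum => k _; exact: fD.
  rewrite sumEFin lee_fin -mulr_sumr mulrC ler_wpM2r//.
  suff -> : \sum_(0 <= k < K) 2^-1 ^+ k = 2 - 2 * 2^-1 ^+ K :> R.
    by rewrite lerBlDr lerDl mulr_ge0// exprn_ge0// invr_ge0.
  elim: K => [|K IH]; first by rewrite big_nil expr0; lra.
  by rewrite big_nat_recr//= IH exprS; field.
apply: (@le_trans _ _ ((2 * M ^+ 2 * A)%:E + (2 * D)%:E)%E); first exact: leeD2l.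
rewrite -EFinD lee_fin le_eqVlt; apply/orP; left; apply/eqP.
by rewrite /D; field; rewrite gt_eqF.
Qed.

End Comparison.

(** * The equivalences *)

Section Constants.
Context d (T : measurableType d) (R : realType) (P : probability T R).
Variables (xi : nat -> {RV P >-> R}) (V : normedModType R).
Variable Q : forall n, ('I_n -> V) -> R.
Hypothesis Q0 : forall n (x : 'I_n -> V), 0 <= Q x.
Hypothesis QE : forall n (x : 'I_n -> V), random_sum_L2 xi x = (Num.sqrt (Q x))%:E.

(** Stated for an abstract mean square Q, which is [sqmean xi] in one use and [radavg] in the
    other. *)
Lemma has_type2P : has_type2 xi V <->
  exists2 B : R, 0 <= B &
    forall n (y : 'I_n -> V), Q y <= B * \sum_j `|y j| ^+ 2.
Proof.
split=> [/ereal_inf_lt[C [C0 HC]]|[B B0 HB]].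
  case: C C0 HC => [c||]//; rewrite lee_fin => c0 HC _.
  exists (c ^+ 2); first exact: sqr_ge0.
  move=> n y; have := HC n y; rewrite QE -EFinM lee_fin => H.
  rewrite -(sqr_sqrtr (Q0 y)).
  have S0 : 0 <= \sum_j `|y j| ^+ 2 by rewrite sumr_ge0// => j _; exact: sqr_ge0.
  rewrite -[X in _ * X](sqr_sqrtr S0) -exprMn.
  by rewrite lerXn2r ?nnegrE ?mulr_ge0 ?sqrtr_ge0.
apply: le_lt_trans (ltry (Num.sqrt B)); apply: ereal_inf_lbound; split.
  by rewrite lee_fin sqrtr_ge0.
by move=> n y; rewrite QE -EFinM -sqrtrM// lee_fin ler_wsqrtr.
Qed.

Lemma has_cotype2P : has_cotype2 xi V <->
  exists2 B : R, 0 <= B &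
    forall n (x : 'I_n -> V), \sum_j `|x j| ^+ 2 <= B * Q x.
Proof.
split=> [/ereal_inf_lt[C [C0 HC]]|[B B0 HB]].
  case: C C0 HC => [c||]//; rewrite lee_fin => c0 HC _.
  exists (c ^+ 2); first exact: sqr_ge0.
  move=> n x; have := HC n x; rewrite QE -EFinM lee_fin => H.
  have S0 : 0 <= \sum_j `|x j| ^+ 2 by rewrite sumr_ge0// => j _; exact: sqr_ge0.
  rewrite -(sqr_sqrtr (Q0 x)) -(sqr_sqrtr S0) -exprMn.
  by rewrite lerXn2r ?nnegrE ?mulr_ge0 ?sqrtr_ge0.
apply: le_lt_trans (ltry (Num.sqrt B)); apply: ereal_inf_lbound; split.
  by rewrite lee_fin sqrtr_ge0.
by move=> n x; rewrite QE -EFinM -sqrtrM// lee_fin ler_wsqrtr.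
Qed.

End Constants.

Section LipNorm.
Context (R : realType) (X Y : normedModType R).
Implicit Type f : X -> Y.

Lemma lipschitzP (k : R) f :
  k.-lipschitz f <-> forall x y, `|f x - f y| <= k * `|x - y|.
Proof. by split=> [H x y|H [x y] _]; [exact: (H (x, y))|exact: H]. Qed.

Lemma Lip_norm_ge0 f : 0 <= Lip_norm f.
Proof.
have [ne|ne] := pselect ([set k : R | 0 <= k /\ k.-lipschitz f] !=set0).
  by apply: lb_le_inf => // k [].
by rewrite /Lip_norm inf_out// => -[].
Qed.

Lemma Lip_norm_le k f : 0 <= k -> (forall x y, `|f x - f y| <= k * `|x - y|) ->
  Lip_norm f <= k.
Proof.
move=> k0 fk; apply: ge_inf; last by split=> //; exact/lipschitzP.
by exists 0 => r [].
Qed.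

Lemma Lip0_of_lipschitz k f : f 0 = 0 ->
  (forall x y, `|f x - f y| <= k * `|x - y|) -> Lip0 f.
Proof.
move=> f0 fk; split=> //; apply: (@klipschitzW _ _ _ k).
  exact: (@globally_properfilter _ _ (0, 0)).
exact/lipschitzP.
Qed.

Lemma Lip0_norm_le f x : Lip0 f -> `|f x| <= Lip_norm f * `|x|.
Proof.
move=> [f0 [M [_ fM]]].
have [->|x0] := eqVneq x 0; first by rewrite f0 !normr0 mulr0.
have xgt : 0 < `|x| by rewrite normr_gt0.
rewrite -ler_pdivrMr//; apply: lb_le_inf.
  (* [lipschitz] provides the inequality for all constants above some M; this one is also
     nonnegative. *)
  exists (Num.max M 0 + 1); split; first by rewrite addr_ge0// le_max lexx orbT.
  by apply: fM; rewrite (le_lt_trans (_ : M <= Num.max M 0)) ?ltrDl// le_max lexx.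
move=> k [k0 /lipschitzP/(_ x 0)].
by rewrite f0 !subr0 ler_pdivrMr.
Qed.

End LipNorm.

Section Theorem2.
Context d (T : measurableType d) (R : realType) (P : probability T R).
Variable xi : nat -> {RV P >-> R}.
Hypotheses (xi_iid : iid xi) (xi_sym : forall j, symmetric_rv (xi j)).
Hypothesis xi_var : forall j, 'E_P[fun w => (`|xi j w| ^+ 2)%R]%E = 1%E.

Lemma sqmean_le_pointwise (V : normedModType R) n (x : 'I_n -> V) (c : 'I_n -> R) :
  (forall j, 0 <= c j) -> (forall t, sqnorm_comb x t <= \sum_j c j * t j ^+ 2) ->
  sqmean xi x <= \sum_j c j.
Proof.
move=> c0 H; have mxi (j : 'I_n) : measurable_fun setT (xi j) by exact: measurable_funPT.
rewrite -lee_fin sqmeanE//.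
apply: (@le_trans _ _ (\int[P]_w (\sum_j c j * xi j w ^+ 2)%:E)%E).
  apply: ge0_le_integral => //.
  - by move=> w _; rewrite lee_fin sqr_ge0.
  - by apply/measurable_EFinP; exact: (measurable_sqnorm_comb x mxi).
  - by apply/measurable_EFinP; exact: (measurable_sum_sqr c mxi).
  - by move=> w _; rewrite lee_fin; exact: H.
rewrite (integral_sum_sqr P c0 mxi).
by under eq_bigr do rewrite (integral_sqr_rv xi_var) mule1; rewrite sumEFin.
Qed.

(** The absolute value is needed because K has no sign, and for n = 0 the maximum is 0 and not
    [Lip_norm f]. *)
Lemma families_single (X Y : normedModType R) K :
  families_Lip_bounded xi X Y K -> single_Lip_bounded xi X Y `|K|.
Proof.
move=> H f n x f0; exists (fun=> 1) => //.
apply: (le_trans (H n (fun=> f) x (fun=> 1) (fun=> f0) (fun=> ltr01))).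
apply: lee_wpmul2r; first exact: sqrte_ge0.
rewrite -!EFinM lee_fin.
have b0 : 0 <= \big[Num.max/0]_(j < n) Lip_norm f by exact: bigmax_ge_id.
apply: (@le_trans _ _ (`|K| * \big[Num.max/0]_(j < n) Lip_norm f)).
  by apply: ler_wpM2r => //; exact: ler_norm.
by apply: ler_wpM2l => //; apply/bigmax_leP; split=> //; exact: Lip_norm_ge0.
Qed.

Lemma type_cotype_families (X Y : normedModType R) :
  has_cotype2 xi X -> has_type2 xi Y -> exists K, families_Lip_bounded xi X Y K.
Proof.
move=> /(has_cotype2P (@sqmean_ge0 _ _ _ _ xi X) (random_sum_L2E xi_var (V := X)))[Bc Bc0 cot].
move=> /(has_type2P (@sqmean_ge0 _ _ _ _ xi Y) (random_sum_L2E xi_var (V := Y)))[Bt Bt0 typ].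
exists (Num.sqrt (Bt * Bc)) => n f x a f0 a0.
set L := \big[Num.max/0]_(j < n) _.
have L0 : 0 <= L by exact: bigmax_ge_id.
rewrite !(random_sum_L2E xi_var) -!EFinM lee_fin.
rewrite -[L]ger0_norm// -sqrtr_sqr -!sqrtrM ?mulr_ge0 ?sqr_ge0//.
apply: ler_wsqrtr; apply: (le_trans (typ _ _)).
have fx : \sum_j `|(a j)^-1 *: f j (a j *: x j)| ^+ 2 <= L ^+ 2 * \sum_j `|x j| ^+ 2.
  rewrite mulr_sumr; apply: ler_sum => j _; rewrite -exprMn.
  rewrite lerXn2r ?nnegrE ?mulr_ge0// normrZ gtr0_norm ?invr_gt0//.
  rewrite ler_pdivrMl//; apply: (le_trans (Lip0_norm_le _ (f0 j))).
  rewrite normrZ gtr0_norm// mulrCA ler_wpM2l ?(ltW (a0 j))// ler_wpM2r//.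
  exact: (le_bigmax _ (fun j => Lip_norm (f j))).
apply: (le_trans (ler_wpM2l Bt0 fx)); rewrite mulrA.
have -> : Bt * Bc * L ^+ 2 * sqmean xi x = Bt * L ^+ 2 * (Bc * sqmean xi x) by ring.
by apply: ler_wpM2l (cot n x); rewrite mulr_ge0// sqr_ge0.
Qed.

Section Necessity.
Context (X Y : normedModType R) (K : R).
Hypotheses (dimX : ~ finite_dimensional X) (dimY : exists y : Y, y != 0).
Hypothesis HK : single_Lip_bounded xi X Y K.

(** The factor c is the Lipschitz constant of the test map. It is kept because K c <= K requires K
    >= 0, which is itself derived from this bound. *)
Lemma norm_map_bound n (x : 'I_n -> X) : exists2 c : R, 0 <= c <= 1 &
  Num.sqrt (\sum_j `|x j| ^+ 2) <= K * c * Num.sqrt (sqmean xi x).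
Proof.
have [y0 y00] := dimY.
pose y := `|y0|^-1 *: y0.
have y1 : `|y| = 1.
  by rewrite normrZ ger0_norm ?invr_ge0// mulVf// normr_eq0.
pose f (z : X) : Y := `|z| *: y.
have f0 : f 0 = 0 by rewrite /f normr0 scale0r.
have fl z z' : `|f z - f z'| <= 1 * `|z - z'|.
  by rewrite -scalerBl normrZ y1 mulr1 mul1r ler_dist_dist.
have [a a0] := HK x (Lip0_of_lipschitz f0 fl).
rewrite (_ : (fun j => _) = (fun j => `|x j| *: y)); last first.
  apply/funext => j; rewrite /f normrZ gtr0_norm// scalerA mulrA mulVf ?mul1r//.
  by rewrite gt_eqF.
rewrite !(random_sum_L2E xi_var) sqmean_line// y1 expr1n mulr1 -!EFinM lee_fin => H.
by exists (Lip_norm f) => //; rewrite Lip_norm_ge0 Lip_norm_le.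
Qed.

Lemma single_bound_ge0 : 0 <= K.
Proof.
have [w wfree] := free_family dimX 1.
have x0 : w 0 != 0.
  apply/eqP => w0; have := wfree 1%:M; rewrite /comb big_ord1 w0 scaler0.
  by move=> /(_ erefl)/matrixP/(_ 0 0)/eqP; rewrite !mxE eqxx oner_eq0.
have [c /andP[c0 _]] := norm_map_bound w.
rewrite big_ord1 sqrtr_sqr normr_id => H; rewrite leNgt; apply/negP => K0.
have : `|w 0| <= 0.
  apply: (le_trans H); rewrite -mulrA nmulr_rle0// mulr_ge0// sqrtr_ge0.
by rewrite normr_le0 (negbTE x0).
Qed.

Lemma cotype_of_single : (cotype2_const xi X <= K%:E)%E.
Proof.
have K0 := single_bound_ge0.
apply: ereal_inf_lbound; split; first by rewrite lee_fin.
move=> n x; rewrite (random_sum_L2E xi_var) -EFinM lee_fin.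
have [c /andP[c0 c1] H] := norm_map_bound x.
by rewrite (le_trans H)// ler_wpM2r ?sqrtr_ge0// ler_piMr.
Qed.

Lemma type_of_single : (type2_const xi Y <= ((1 + 2 * Num.sqrt 2) * K)%:E)%E.
Proof.
have K0 := single_bound_ge0.
apply: ereal_inf_lbound; split.
  by rewrite lee_fin mulr_ge0// addr_ge0// mulr_ge0// sqrtr_ge0.
move=> n y; rewrite (random_sum_L2E xi_var) -EFinM lee_fin.
pose u j := `|y j|^-1 *: y j.
have u1 j : `|u j| <= 1.
  rewrite normrZ ger0_norm ?invr_ge0//.
  by have [->|h] := eqVneq `|y j| 0; rewrite ?mulr0// mulVf.
have [e [f [s [f0 fl s_ge e_up fe]]]] := prescribed_lipschitz dimX u1.
have s0 j : 0 < s j by apply: lt_le_trans (s_ge j); lra.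
(* Chosen so that f maps x_j to y_j; by homogeneity the scalars a_j then cancel. *)
pose x j := (`|y j| / s j) *: e j.
have [a a0] := HK x (Lip0_of_lipschitz f0 fl).
rewrite (_ : (fun j => _) = y); last first.
  apply/funext => j; have [yj|yj] := eqVneq (y j) 0.
    by rewrite /x yj normr0 mul0r scale0r scaler0 f0 scaler0.
  have yj0 : 0 < `|y j| by rewrite normr_gt0.
  rewrite /x scalerA fe; last by rewrite mulr_gt0// divr_gt0.
  rewrite /u !scalerA (_ : _ * _ = 1) ?scale1r//.
  by field; rewrite !gt_eqF.
rewrite !(random_sum_L2E xi_var) -!EFinM lee_fin => H; apply: (le_trans H).
have fL : Lip_norm f <= 2 by exact: Lip_norm_le.
set S := \sum_j `|y j| ^+ 2.
have S0 : 0 <= S by rewrite sumr_ge0// => j _; exact: sqr_ge0.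
have xS : sqmean xi x <= (100 / 53) ^+ 2 * S.
  pose c j := (`|y j| / s j) ^+ 2.
  apply: (@le_trans _ _ (\sum_j c j)).
    apply: sqmean_le_pointwise => [j|t]; first exact: sqr_ge0.
    have := e_up (\row_j (t j * (`|y j| / s j))).
    have -> : comb e (\row_j (t j * (`|y j| / s j))) = \sum_j t j *: x j.
      by apply: eq_bigr => j _; rewrite mxE scalerA.
    have -> : sqn (\row_j (t j * (`|y j| / s j))) = \sum_j c j * t j ^+ 2.
      by apply: eq_bigr => j _; rewrite mxE exprMn mulrC.
    by [].
  rewrite mulr_sumr; apply: ler_sum => j _; rewrite -exprMn /c mulrC.
  rewrite lerXn2r ?nnegrE ?mulr_ge0 ?invr_ge0 ?(ltW (s0 j))//.
  apply: ler_wpM2r => //; rewrite -[leLHS]mul1r ler_pdivrMr//.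
  by have := s_ge j; lra.
have xS' : Num.sqrt (sqmean xi x) <= 100 / 53 * Num.sqrt S.
  apply: (le_trans (ler_wsqrtr xS)).
  have h : 0 <= 100 / 53 :> R by lra.
  by rewrite sqrtrM ?sqr_ge0// sqrtr_sqr ger0_norm.
(* With this bound 1 + 2 sqrt 2 >= 3.8, which exceeds 2 (100/53). *)
have sq2 : 14 / 10 <= Num.sqrt 2 :> R.
  have h : 0 <= 14 / 10 :> R by lra.
  by rewrite -(@ler_pXn2r _ 2) ?nnegrE ?sqrtr_ge0// sqr_sqrtr//; lra.
apply: (@le_trans _ _ (K * 2 * (100 / 53 * Num.sqrt S))).
  apply: ler_pM => //; rewrite ?sqrtr_ge0//.
    by rewrite mulr_ge0// Lip_norm_ge0.
  by rewrite ler_wpM2l.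
rewrite mulrA; apply: ler_wpM2r; first exact: sqrtr_ge0.
rewrite -mulrA mulrC; apply: ler_wpM2r => //; lra.
Qed.

End Necessity.

(* M is chosen so that, for n nonzero vectors, a Rademacher cotype bound b improves
   to D + b / 2 with D independent of n; the iteration starts from b = n. *)
Lemma rad_cotype_of_cotype (V : normedModType R) (B : R) : 0 <= B ->
  (forall j, finite_moments (xi j)) ->
  (forall n (x : 'I_n -> V), \sum_j `|x j| ^+ 2 <= B * sqmean xi x) ->
  exists2 B' : R, 0 <= B' &
    forall n (x : 'I_n -> V), \sum_j `|x j| ^+ 2 <= B' * radavg x.
Proof.
move=> B0 mom cot.
pose m := fourth_moment xi.
have m0 : 0 <= m := fourth_moment_ge0 xi.
(* M^2 >= 128 m B makes 64 m B / M^2 at most 1/2; the summand 1 keeps M positive. *)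
pose M := Num.sqrt (128 * m * B + 1).
have M21 : 0 < 128 * m * B + 1 by rewrite ltr_wpDl// !mulr_ge0.
have M2 : M ^+ 2 = 128 * m * B + 1 by rewrite sqr_sqrtr// ltW.
have M0 : 0 < M by rewrite sqrtr_gt0.
pose D := 2 * B * M ^+ 2.
have D0 : 0 <= D by rewrite mulr_ge0 ?sqr_ge0// mulr_ge0.
have improve N b : 0 <= b -> rad_cotype_upto V N b -> rad_cotype_upto V N (D + b / 2).
  move=> b0 Nb n x supp; apply: (le_trans (cot n x)).
  have := sqmean_le_radavg xi_iid xi_sym xi_var mom b0 M0 Nb supp.
  move=> /(ler_wpM2l B0)/le_trans; apply; rewrite mulrA.
  apply: ler_wpM2r; first exact: radavg_ge0.
  rewrite -/m mulrDr (_ : B * (2 * M ^+ 2) = D); last by rewrite /D; ring.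
  rewrite lerD2l (_ : B * _ = b * (64 * m * B / M ^+ 2)); last by ring.
  apply: ler_wpM2l => //; rewrite ler_pdivrMr ?exprn_gt0// M2; lra.
exists (2 * D); first by rewrite mulr_ge0.
move=> n x; apply/ler_addgt0Pr => eps eps0.
(* 2 D is the fixed point of b -> D + b/2, and each step halves the distance to it. *)
have iter k : rad_cotype_upto V n (2 * D + n%:R / 2 ^+ k).
  elim: k => [|k IH].
    move=> l z supp; apply: (le_trans (rad_cotype_upto_trivial supp)).
    by apply: ler_wpM2r; rewrite ?radavg_ge0// expr0 divr1 lerDr mulr_ge0.
  have := improve n _ _ IH.
  rewrite (_ : D + _ / 2 = 2 * D + n%:R / 2 ^+ k.+1); last first.
    rewrite exprS; have : 2 ^+ k != 0 :> R by rewrite expf_neq0.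
    by move: (2 ^+ k) => z z0; field.
  apply; apply: addr_ge0; first exact: mulr_ge0.
  by rewrite divr_ge0// exprn_ge0.
have rx := radavg_ge0 x.
have nr : 0 <= n%:R * radavg x / eps.
  by apply: divr_ge0; [exact: mulr_ge0|exact: ltW].
have supp : (#|[pred i | x i != 0%R]| <= n)%N by rewrite -[X in (_ <= X)%N]card_ord max_card.
apply: (le_trans (iter (Num.bound (n%:R * radavg x / eps)) n x supp)).
rewrite mulrDl lerD2l mulrAC ler_pdivrMr ?exprn_gt0// [leRHS]mulrC -ler_pdivrMr//.
apply/ltW/(lt_le_trans (archi_boundP nr)).
by rewrite -natrX ler_nat ltnW// ltn_expl.
Qed.

(** The moments enter through [rad_cotype_of_cotype]. Type for the signs and cotype for xi follow
    from [low]; type for xi follows by symmetrization. *)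
Lemma type_cotype_rademacher (X Y : normedModType R)
    (d' : measure_display) (T' : measurableType d') (P' : probability T' R)
    (r : nat -> {RV P' >-> R}) :
  (forall j, finite_moments (xi j)) -> rademacher r ->
  (has_cotype2 xi X /\ has_type2 xi Y) <-> (has_cotype2 r X /\ has_type2 r Y).
Proof.
move=> mom rad.
have rE (V : normedModType R) n (x : 'I_n -> V) :
    random_sum_L2 r x = (Num.sqrt (radavg x))%:E.
  by rewrite /random_sum_L2 (expectation_rademacher rad).
have cX := has_cotype2P (@sqmean_ge0 _ _ _ _ xi X) (random_sum_L2E xi_var (V := X)).
have tY := has_type2P (@sqmean_ge0 _ _ _ _ xi Y) (random_sum_L2E xi_var (V := Y)).
have cX' := has_cotype2P (fun n => @radavg_ge0 R X 'I_n) (rE X).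
have tY' := has_type2P (fun n => @radavg_ge0 R Y 'I_n) (rE Y).
pose p := tail xi (1 / 2) ^+ 2 / 4.
have p0 : 0 < p by rewrite divr_gt0// exprn_gt0// tail_half_gt0.
have low (V : normedModType R) n (x : 'I_n -> V) : radavg x <= p^-1 * sqmean xi x.
  by rewrite ler_pdivlMl//; exact: radavg_le_sqmean.
have pV0 : 0 <= p^-1 by rewrite invr_ge0 ltW.
split=> -[].
  move=> /cX[Bc Bc0 cot] /tY[Bt Bt0 typ]; split.
    by apply/cX'; exact: rad_cotype_of_cotype cot.
  apply/tY'; exists (p^-1 * Bt); first exact: mulr_ge0.
  move=> n y; rewrite -mulrA; apply: (le_trans (low _ _ _)).
  exact: ler_wpM2l.
move=> /cX'[Bc Bc0 cot] /tY'[Bt Bt0 typ]; split.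
  apply/cX; exists (Bc * p^-1); first exact: mulr_ge0.
  move=> n x; apply: (le_trans (cot _ _)); rewrite -mulrA.
  by apply: ler_wpM2l => //; exact: low.
apply/tY; exists Bt => // n y.
exact: (sqmean_le_sum xi_iid xi_sym xi_var y Bt0 (typ n)).
Qed.

End Theorem2.

Theorem theorem2 (R : realType) (X Y : completeNormedModType R)
    (d : measure_display) (T : measurableType d) (P : probability T R)
    (xi : nat -> {RV P >-> R})
    (dimX : ~ finite_dimensional X) (dimY : exists y : Y, y != 0)
    (xi_iid : iid xi) (xi_sym : forall j, symmetric_rv (xi j))
    (xi_var : forall j, 'E_P[fun w => (`|xi j w| ^+ 2)%R]%E = 1%E) :
  [/\ (exists K : R, families_Lip_bounded xi X Y K) <->
        (exists K : R, single_Lip_bounded xi X Y K),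
      (exists K : R, single_Lip_bounded xi X Y K) <->
        (has_cotype2 xi X /\ has_type2 xi Y),
      (forall K : R, single_Lip_bounded xi X Y K ->
        (cotype2_const xi X <= K%:E)%E /\
        (type2_const xi Y <= ((1 + 2 * Num.sqrt 2) * K)%:E)%E) &
      ((forall j, finite_moments (xi j)) ->
        forall (d' : measure_display) (T' : measurableType d')
          (P' : probability T' R) (r : nat -> {RV P' >-> R}),
          rademacher r ->
          ((has_cotype2 xi X /\ has_type2 xi Y) <->
           (has_cotype2 r X /\ has_type2 r Y)))].
Proof.
have constants K : single_Lip_bounded xi X Y K ->
    (cotype2_const xi X <= K%:E)%E /\
    (type2_const xi Y <= ((1 + 2 * Num.sqrt 2) * K)%:E)%E.
  move=> HK; split.
    exact: (cotype_of_single xi_iid xi_sym xi_var dimX dimY HK).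
  exact: (type_of_single xi_iid xi_sym xi_var dimX dimY HK).
have single_families : (exists K : R, families_Lip_bounded xi X Y K) ->
    exists K : R, single_Lip_bounded xi X Y K.
  by move=> [K HK]; exists `|K|; exact: families_single.
have necessity : (exists K : R, single_Lip_bounded xi X Y K) ->
    has_cotype2 xi X /\ has_type2 xi Y.
  by move=> [K /constants[hc ht]]; split; [exact: le_lt_trans hc (ltry _)|
    exact: le_lt_trans ht (ltry _)].
have sufficiency : has_cotype2 xi X /\ has_type2 xi Y ->
    exists K : R, families_Lip_bounded xi X Y K.
  by move=> [hc ht]; exact: type_cotype_families.
split=> //.
- by split=> // /necessity/sufficiency.
- by split=> // /sufficiency/single_families.
- by move=> mom d' T' P' r rad; exact: type_cotype_rademacher.
Qed.
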